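(* Let $\lambda>0$, $r>0$ and $\lambda_r=\lambda/(\pi r^2)$. Conditional on halting, the partial rejection sampling algorithm for hard disks with parameters $(\lambda,r)$ outputs a sample from the hard disks distribution on $[0,1]^2$ with intensity $\lambda_r$; that is, the conditional law of its output given that it halts equals the law of $\Pi$ conditioned on $\mathrm{BadPoints}(\Pi)=\emptyset$, where $\Pi$ is a Poisson point process of intensity $\lambda_r$ on $[0,1]^2$.
   Context: $\|\cdot\|$ is the Euclidean norm. For a finite set $P\subset[0,1]^2$, let $\mathrm{BadPairs}(P)=\{\{x,y\}: x,y\in P,\ x\neq y,\ \|x-y\|<2r\}$ and $\mathrm{BadPoints}(P)=\bigcup \mathrm{BadPairs}(P)$, i.e. the set of points of $P$ belonging to some bad pair. $D_{2r}(\mathbf 0)$ is the open disk of radius $2r$ centred at the origin, and $+$ denotes Minkowski sum. Hard disks distribution with intensity $\lambda_r$: the law of a Poisson point process $\Pi$ of (constant) intensity $\lambda_r$ on $[0,1]^2$, conditioned on the event $\mathrm{BadPoints}(\Pi)=\emptyset$ (no two distinct points at distance less than $2r$). The partial rejection sampling algorithm with parameters $(\lambda,r)$: 1. Let $P$ be a sample of the Poisson point process of intensity $\lambda_r$ on $[0,1]^2$. 2. While $B:=\mathrm{BadPoints}(P)\neq\emptyset$: let $S=(B+D_{2r}(\mathbf 0))\cap[0,1]^2$; draw, using fresh independent randomness, a sample $P^S$ of the Poisson point process of intensity $\lambda_r$ on $S$; replace $P$ by $(P\setminus B)\cup P^S$. 3. Halt and output $P$. *)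

(* Defs.v *)
From HB Require Import structures.
From mathcomp Require Import all_boot all_order all_algebra finmap.
From mathcomp Require Import all_classical all_reals all_analysis.

Set Implicit Arguments.
Unset Strict Implicit.
Unset Printing Implicit Defensive.

Import Order.TTheory GRing.Theory Num.Theory.
Import numFieldNormedType.Exports.

Local Open Scope fset_scope.
Local Open Scope classical_set_scope.
Local Open Scope ring_scope.

Section geometry.
Context {R : realType}.
Implicit Types (r : R) (P : {fset R * R}).

(* The norm that the library puts on [R * R] is the sup norm. *)
Definition enorm (z : R * R) : R := Num.sqrt (z.1 ^+ 2 + z.2 ^+ 2).

Definition unit_square : set (R * R) := `[0, 1] `*` `[0, 1].

Definition open_disk (rho : R) : set (R * R) := [set z | enorm z < rho].

Definition bad_pairs r P : {fset {fset R * R}} :=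
  [fset [fset x; y] | x in P, y in P & (x != y) && (enorm (x - y) < 2 * r)].

Definition bad_points r P : {fset R * R} := fcover (bad_pairs r P).

Definition resample_region r P : set (R * R) :=
  [set x + z | x in [set` bad_points r P] & z in open_disk (2 * r)]
    `&` unit_square.

End geometry.

Section configurations.
Context {R : realType}.

Definition count_in (A : set (R * R)) (X : {fset R * R}) : nat :=
  #|` [fset x in X | x \in A] |.

Definition count_events : set (set {fset R * R}) :=
  [set C | exists A k, measurable A /\ C = [set X | count_in A X = k]].

(* Finite point configurations, with the sigma-algebra generated by the
   counts in the Borel subsets of the plane. *)
Definition config : Type := g_sigma_algebraType count_events.

HB.instance Definition _ := Measurable.on config.

Definition area :
    {measure set (measurableTypeR R * measurableTypeR R) -> \bar R} :=
  (lebesgue_measure \x lebesgue_measure)%E.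

(* [mu] is the law of a Poisson point process of constant intensity [lam] on
   the bounded Borel set [S]: the numbers of points in disjoint Borel sets [A i]
   are independent and Poisson with means [lam * area (A i `&` S)].  The case
   [A] disjoint from [S] says that there is almost surely no point outside [S].
   The library's [poisson_pmf] is not a probability mass function at rate [0],
   hence the use of [poisson_prob], which is the Dirac mass at [0] there and
   does not depend on its second argument. *)
Definition is_poisson_process (lam : R) (S : set (R * R))
    (mu : {measure set config -> \bar R}) : Prop :=
  forall (n : nat) (A : 'I_n -> set (R * R)) (k : 'I_n -> nat),
    (forall i, measurable (A i)) -> trivIset setT A ->
    mu [set X | forall i, count_in (A i) X = k i] =
    (\prod_(i < n) poisson_prob (lam * fine (area (A i `&` S))) 0%N [set k i])%E.

End configurations.
Arguments config : clear implicits.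

Section algorithm.
Context {R : realType}.
Implicit Types (r : R) (q : nat -> {fset R * R}).

(* The point set after [t] rounds, when the successive Poisson samples are
   [q 0] (initial), [q 1], [q 2], ...; only its values up to the first [t] such
   that [bad_points r (state r q t) = fset0] are used. *)
Fixpoint state r q (t : nat) : {fset R * R} :=
  if t is t'.+1
  then ((state r q t' `\` bad_points r (state r q t')) `|` q t'.+1)%fset
  else q 0%N.

Definition outputs r q (X : {fset R * R}) : Prop :=
  exists t, [/\ forall s, (s < t)%N -> bad_points r (state r q s) <> fset0,
                bad_points r (state r q t) = fset0
              & state r q t = X].

Definition halts r q : Prop := exists X, outputs r q X.

End algorithm.

Section run.
Context {R : realType} d (T : measurableType d) (P : probability T R).
Implicit Types (Q : nat -> {RV P >-> config R}) (t : nat).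

Definition history Q t : set (set T) :=
  <<s [set H | exists i (F : set (config R)),
        [/\ (i <= t)%N, measurable F & H = Q i @^-1` F]] >>.

Definition running r Q t : set T :=
  [set w | forall s, (s <= t)%N ->
     bad_points r (state r (fun i => Q i w) s) <> fset0].

(* [Q] is the sequence of Poisson samples drawn in a run of the algorithm, and
   [K X] is the law of the sample to be drawn when the current point set is [X].
   Freshness: as long as the loop runs, [K (state r _ t)] is the regular
   conditional law of [Q t.+1] given all the samples drawn before. *)
Record prs_run (lam r : R) Q (K : R.-pker (config R) ~> (config R)) : Prop :=
  PRSRun {
    prs_init : is_poisson_process lam unit_square (distribution P (Q 0%N));
    prs_kernel : forall X : config R,
      is_poisson_process lam (resample_region r X) (K X);
    prs_fresh : forall t (H : set T) (F : set (config R)),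
      history Q t H -> H `<=` running r Q t -> measurable F ->
      P (H `&` Q t.+1 @^-1` F) =
      (\int[P]_(w in H) K (state r (fun i => Q i w) t) F)%E }.

(* When [P H = 0] this is [0] for every [A], hence not a probability. *)
Definition cond_prob (H A : set T) : \bar R := (P (A `&` H) / P H)%E.

End run.

Definition hard_disks {R : realType} (r : R) (Pi : probability (config R) R) :
    set (config R) -> \bar R :=
  cond_prob Pi [set X | bad_points r X = fset0].

(* Main.v *)
Require Import Defs.
From HB Require Import structures.
From mathcomp Require Import all_boot all_order all_algebra finmap.
From mathcomp Require Import all_classical all_reals all_analysis.
From mathcomp Require Import measurable_realfun lra.
Import Order.TTheory GRing.Theory Num.Theory.
Import numFieldNormedType.Exports.
Local Open Scope classical_set_scope.
Local Open Scope ring_scope.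

Set Implicit Arguments.
Unset Strict Implicit.
Unset Printing Implicit Defensive.

(* Let [Pi] be the Poisson law on the square.  By induction, the law of the
   point set at round [t], on the event that the loop has not stopped earlier,
   has a density with respect to [Pi] that depends on a configuration only
   through its bad points; hence on the hard configurations it is a constant
   times [Pi], and summing over [t] gives the theorem.

   The induction step rests on the following fact: given its bad points [B], the
   rest of a Poisson sample is distributed as the hard disks at distance at least
   [2r] from [B].  Resampling near [B] then produces a Poisson sample conditioned
   to be hard away from [B], a condition that only concerns the bad points of the
   new sample.

   No conditioning on the null event [bad X = B] is needed.  In a grid of side
   [r], every point lying in the cell of a bad point is itself bad, so if [D] is
   the set of cells that contain bad points, then the bad points are exactly the
   points of [X] in [D].  For each of the countably many values of [D], the
   claim follows from the independence of the restrictions of [X] to a Borel set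
   and to its complement, used for [D] and then for the neighbourhood of [B]. *)

(** * Measurability of operations on configurations *)

Section measurable_configurations.
Context {R : realType}.
Implicit Types (A : set (R * R)) (X Y : config R).

(** As a sum of Dirac masses at the points of [X], the count extends to sets that vary with a
    parameter. *)
Lemma count_inE A X :
  ((count_in A X)%:R : R)%:E = (\sum_(x <- (X : {fset R * R})) \d_x A :> \bar R)%E.
Proof.
rewrite /count_in; under eq_bigr do rewrite diracE.
rewrite sumEFin; congr _%:E.
rewrite card_fset_sum1 natr_sum big_fset big_mkcond /=.
by apply: eq_bigr => x _; case: (x \in A).
Qed.

Lemma measurable_count A : measurable A ->
  measurable_fun setT (fun X : config R => ((count_in A X)%:R : R)%:E).
Proof.
move=> mA _ Y mY; rewrite setTI.
rewrite [X in measurable X](_ : _ =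
  \bigcup_(k in [set k : nat | Y k%:R%:E]) [set X | count_in A X = k]); last first.
  by apply/seteqP; split=> [X /= YX|X [k /= Yk] ->//]; exists (count_in A X).
apply: bigcup_measurable => k _; apply: sub_sigma_algebra.
by exists A, k.
Qed.

Lemma measurable_count_eq A k : measurable A ->
  measurable ([set X | count_in A X = k] : set (config R)).
Proof. by move=> mA; apply: sub_sigma_algebra; exists A, k. Qed.

Lemma measurable_to_config d (T : measurableType d) (f : T -> config R) :
  (forall A, measurable A ->
    measurable_fun setT (fun t => ((count_in A (f t))%:R : R)%:E)) ->
  measurable_fun setT f.
Proof.
move=> mf; apply: (@measurability _ _ T (config R) setT f count_events erefl).
move=> _ [_ [A [k [mA ->]]] <-].
have := mf A mA measurableT [set (k%:R : R)%:E] (emeasurable_set1 _).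
congr measurable; apply/seteqP; split=> t [_ /=] => [[/eqP]|->] //.
by rewrite eqr_nat => /eqP.
Qed.

(** This is what makes selections by a random region measurable. Dynkin's theorem reduces it to
    rectangles, where the sum is a count times an indicator. *)
Lemma measurable_section_count d (Z : measurableType d) (C : set ((R * R) * Z)) :
  measurable C ->
  measurable_fun setT (fun p : config R * Z =>
    (\sum_(x <- (p.1 : {fset R * R})) \d_(x, p.2) C : \bar R)%E).
Proof.
move: C; pose G := [set A `*` B | A in @measurable _ (R * R)%type & B in @measurable _ Z].
pose PC (C : set ((R * R) * Z)) := measurable_fun setT (fun p : config R * Z =>
    (\sum_(x <- (p.1 : {fset R * R})) \d_(x, p.2) C : \bar R)%E).
suff H : forall S, <<s G >> S -> PC S.
  by move=> C; rewrite measurable_prod_measurableType; exact: H.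
have PT : PC setT.
  rewrite /PC [X in measurable_fun _ X](_ : _ =
    (fun X : config R => ((count_in setT X)%:R : R)%:E) \o fst).
    exact: (measurableT_comp (measurable_count measurableT) measurable_fst).
  apply/funext => p /=; rewrite count_inE; apply: eq_bigr => x _.
  by rewrite !diracE !in_setT.
apply: dynkin_induction => //.
- by rewrite measurable_prod_measurableType.
- move=> _ _ [A mA [B mB <-]] [A' mA' [B' mB' <-]]; rewrite -setXI.
  by exists (A `&` A'); [exact: measurableI|exists (B `&` B') => //; exact: measurableI].
- move=> _ [A mA [B mB <-]]; rewrite /PC [X in measurable_fun _ X](_ : _ =
    (fun p => (((fun X : config R => ((count_in A X)%:R : R)%:E) \o fst) p *
      (\1_B p.2)%:E)%E)).
    apply: emeasurable_funM.
      exact: (measurableT_comp (measurable_count mA) measurable_fst).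
    apply/measurable_EFinP.
    have mI : measurable_fun setT (\1_B : Z -> R) by exact: measurable_indic.
    exact: (measurableT_comp mI measurable_snd).
  apply/funext => p /=; rewrite count_inE.
  rewrite muleC ge0_sume_distrr ?mulr1//.
  apply: eq_bigr => x _; rewrite !diracE indicE -EFinM in_setX /=.
  by rewrite andbC; case: (_ \in B); case: (_ \in A); rewrite /= ?mul1r ?mul0r ?mulr0.
(* Counts are finite, so the complement is obtained by subtraction from the case [setT]. *)
- move=> S mS PS.
  rewrite /PC [X in measurable_fun _ X](_ : _ = (fun p : config R * Z =>
     ((\sum_(x <- (p.1 : {fset R * R})) \d_(x, p.2) setT) -
     (\sum_(x <- (p.1 : {fset R * R})) \d_(x, p.2) S) : \bar R)%E)).
    by apply: emeasurable_funB.
  apply/funext => p; under eq_bigr do rewrite diracE.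
  under [in RHS]eq_bigr do rewrite diracE.
  under [X in (_ - X)%E]eq_bigr do rewrite diracE.
  rewrite !sumEFin -EFinB -sumrB; congr _%:E; apply: eq_bigr => x _.
  by rewrite in_setC in_setT; case: (_ \in S); rewrite ?subrr ?subr0.
- move=> F mF tF PF.
  rewrite /PC [X in measurable_fun _ X](_ : _ = (fun p : config R * Z =>
     (\sum_(0 <= n <oo) \sum_(x <- (p.1 : {fset R * R})) \d_(x, p.2) (F n) : \bar R)%E)).
    apply: ge0_emeasurable_sum => n *; last exact: PF.
    by apply: sume_ge0.
  apply/funext => p; rewrite nneseries_sum//; apply: eq_bigr => x _.
  by rewrite measure_bigcup//; apply: eq_eseriesl => n; rewrite in_setT.
Qed.


Definition sel A X : config R := [fset x in (X : {fset R * R}) | x \in A]%fset.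

Lemma in_sel A X x :
  (x \in (sel A X : {fset R * R})) = (x \in (X : {fset R * R})) && (x \in A).
Proof. by rewrite !inE. Qed.

Lemma count_in_sel A A' X : count_in A (sel A' X) = count_in (A `&` A') X.
Proof.
rewrite /count_in; congr #|` _|; apply/fsetP => x.
by rewrite !inE /= in_setI andbAC -andbA.
Qed.

Lemma count_in_eq0 A X :
  count_in A X = 0%N <-> forall x, x \in (X : {fset R * R}) -> ~ A x.
Proof.
rewrite /count_in; split=> [/cardfs0_eq/fsetP X0 x xX Ax|X0].
  by have := X0 x; rewrite !inE /= xX mem_set.
apply/eqP; rewrite cardfs_eq0; apply/eqP/fsetP => x; rewrite !inE /=.
by apply/negP => /andP[xX /set_mem]; exact: X0.
Qed.

(** The region [S t] varies with [t]: the count of the selection in [A] is the sum, over the points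
    [x] of [f t], of the indicator of one measurable set of pairs [(x, t)]. *)
Lemma measurable_sel d (T : measurableType d) (f : T -> config R)
    (S : T -> set (R * R)) :
  measurable_fun setT f -> measurable [set q : (R * R) * T | S q.2 q.1] ->
  measurable_fun setT (fun t => sel (S t) (f t)).
Proof.
move=> mf mS; apply: measurable_to_config => A mA.
set C := [set q : (R * R) * T | S q.2 q.1] `&` (A `*` setT).
have mC : measurable C by apply: measurableI => //; exact: measurableX.
rewrite [X in measurable_fun _ X](_ : _ =
    (fun p : config R * T => (\sum_(x <- (p.1 : {fset R * R})) \d_(x, p.2) C : \bar R)%E)
      \o (fun t => (f t, t))).
  apply: measurableT_comp; first exact: measurable_section_count.
  exact: (measurable_fun_pair mf (@measurable_id _ _ _)).
apply/funext => t; rewrite count_in_sel count_inE; apply: eq_bigr => x _.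
rewrite !diracE; congr ((nat_of_bool _)%:R%:E); apply/idP/idP; rewrite !inE.
  by move=> [].
by move=> [? []].
Qed.

Lemma measurable_exists_point d (T : measurableType d) (f : T -> config R)
    (S : T -> set (R * R)) :
  measurable_fun setT f -> measurable [set q : (R * R) * T | S q.2 q.1] ->
  measurable [set t | exists2 x, x \in (f t : {fset R * R}) & S t x].
Proof.
move=> mf mS; rewrite [X in measurable X](_ : _ =
  ~` ((fun t => sel (S t) (f t)) @^-1` [set X | count_in setT X = 0%N])).
  apply: measurableC; rewrite -[X in measurable X]setTI.
  by apply: measurable_sel => //; exact: measurable_count_eq.
apply/seteqP; split=> t /=.
  move=> [x xf Sx] /count_in_eq0 /(_ x); rewrite in_sel xf mem_set // => /(_ isT); exact.
apply: contra_notP => nS; apply/count_in_eq0 => x.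
by rewrite in_sel => /andP[xf /set_mem Sx] _; apply: nS; exists x.
Qed.

Lemma measurable_point_eq d (T : measurableType d) (f g : T -> R * R) :
  measurable_fun setT f -> measurable_fun setT g ->
  measurable [set t | f t = g t].
Proof.
move=> mf mg.
have m1 (h : T -> R * R) : measurable_fun setT h -> measurable_fun setT (fun t => (h t).1).
  by move=> mh; exact: (measurableT_comp measurable_fst mh).
have m2 (h : T -> R * R) : measurable_fun setT h -> measurable_fun setT (fun t => (h t).2).
  by move=> mh; exact: (measurableT_comp measurable_snd mh).
have := measurable_and (measurable_fun_eqr (m1 _ mf) (m1 _ mg))
   (measurable_fun_eqr (m2 _ mf) (m2 _ mg)).
move=> /(_ measurableT [set true]); rewrite setTI => /(_ I).
congr measurable; apply/seteqP; split => t /=.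
  move=> /andP[/eqP e1 /eqP e2].
  by rewrite [f t]surjective_pairing [g t]surjective_pairing e1 e2.
by move=> ->; rewrite !eqxx.
Qed.

(** [f t] and [g t] may share points, so their counts do not add up; removing from [g t] the points
    of [f t] makes the union disjoint. *)
Lemma measurable_fsetU d (T : measurableType d) (f g : T -> config R) :
  measurable_fun setT f -> measurable_fun setT g ->
  measurable_fun setT (fun t => (f t `|` g t)%fset : config R).
Proof.
move=> mf mg; apply: measurable_to_config => A mA.
pose h t := sel (~` [set y | exists2 x, x \in (f t : {fset R * R}) & y = x]) (g t).
have mh : measurable_fun setT h.
  apply: measurable_sel => //.
  apply: (@measurableC _ _ [set q : (R * R) * T |
    exists2 x, x \in (f q.2 : {fset R * R}) & q.1 = x]).
  apply: (@measurable_exists_point _ _ (fun q : (R * R) * T => f q.2)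
    (fun q x => q.1 = x)).
    exact: measurableT_comp.
  apply: measurable_point_eq => //.
  by apply: measurableT_comp => //; exact: measurable_fst.
rewrite [X in measurable_fun _ X](_ : _ =
  (fun t => ((count_in A (f t))%:R : R)%:E + ((count_in A (h t))%:R : R)%:E)%E); last first.
  apply/funext => t; rewrite -EFinD -natrD; congr (_ %:R%:E).
  have -> : count_in A (f t `|` g t)%fset =
    #|` [fset x in (f t : {fset R * R}) | x \in A]%fset `|`
        [fset x in (h t : {fset R * R}) | x \in A]%fset |%fset.
    congr #|` _|; apply/fsetP => x; rewrite !inE /= in_setC -andb_orl orb_andr.
    congr (_ && _); case: (boolP (x \in f t)) => //= xf; case: (x \in g t) => //=.
    by apply/esym/negP => /set_mem[y yf xy]; rewrite xy yf in xf.
  rewrite cardfsU [X in (_ - X)%N](_ : _ = 0%N) ?subn0//.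
  apply/eqP; rewrite cardfs_eq0; apply/eqP/fsetP => x; rewrite !inE /= in_setC.
  apply/negP => /andP[/andP[xf _] /andP[/andP[_ /negP nx] _]]; apply: nx.
  by rewrite inE; exists x.
by apply: emeasurable_funD; [exact: measurableT_comp (measurable_count mA) mf
                            |exact: measurableT_comp (measurable_count mA) mh].
Qed.

Lemma measurable_config_fst :
  measurable_fun setT (fst : config R * config R -> config R).
Proof. exact: measurable_fst. Qed.

Lemma measurable_config_snd :
  measurable_fun setT (snd : config R * config R -> config R).
Proof. exact: measurable_snd. Qed.

End measurable_configurations.

(** * Geometry of bad points *)

Section bad_points_geometry.
Context {R : realType} (r : R).
Hypothesis r_gt0 : 0 < r.
Implicit Types (A : set (R * R)) (B X Y : config R).

(** This is the Minkowski sum of [B] with the open disk of radius [2 * r], not cut to the unit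
    square. *)
Definition near_of B : set (R * R) :=
  [set x | exists2 y, y \in (B : {fset R * R}) & enorm (x - y) < 2 * r].

Definition inn B X : config R := sel (near_of B) X.
Definition out B X : config R := sel (~` near_of B) X.
Definition bad X : config R := bad_points r X.

Lemma enormN (x : R * R) : enorm (- x) = enorm x.
Proof. by rewrite /enorm /= !sqrrN. Qed.

Lemma enormB (x y : R * R) : enorm (x - y) = enorm (y - x).
Proof. by rewrite -enormN opprB. Qed.

Lemma enorm_lt2r (x : R * R) :
  (enorm x < 2 * r) = (x.1 ^+ 2 + x.2 ^+ 2 < (2 * r) ^+ 2).
Proof.
have r2 : 0 <= 2 * r by rewrite mulr_ge0// ltW.
by rewrite /enorm -[in LHS](ger0_norm r2) -sqrtr_sqr ltr_sqrt// exprn_gt0// mulr_gt0.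
Qed.

Lemma in_bad X x : x \in (bad X : {fset R * R}) <->
  x \in (X : {fset R * R}) /\
  exists2 y, y \in (X : {fset R * R}) & (x != y) && (enorm (x - y) < 2 * r).
Proof.
rewrite /bad /bad_points /fcover; split.
  move=> /bigfcupP[i /andP[/imfset2P[/= y yX [z]]]].
  rewrite !inE => /andP[zX yz] -> _ /fset2P[] ->; first by split => //; exists z.
  by split => //; exists y => //; rewrite eq_sym enormB.
move=> [xX [y yX xy]]; apply/bigfcupP; exists [fset x; y]%fset; last by rewrite !inE eqxx.
by rewrite andbT; apply/imfset2P; exists x => //; exists y => //; rewrite !inE yX.
Qed.

Lemma in_inn B X x : x \in (inn B X : {fset R * R}) <->
  x \in (X : {fset R * R}) /\ near_of B x.
Proof. by rewrite in_sel; split=> [/andP[? /set_mem]|[-> /mem_set]]. Qed.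

Lemma in_out B X x : x \in (out B X : {fset R * R}) <->
  x \in (X : {fset R * R}) /\ ~ near_of B x.
Proof.
by rewrite in_sel; split=> [/andP[? /set_mem]|[-> ?]] //; rewrite mem_set.
Qed.

Lemma fset_ext (X Y : config R) :
  (forall x, x \in (X : {fset R * R}) <-> x \in (Y : {fset R * R})) -> X = Y.
Proof. by move=> XY; apply/fsetP => x; apply/idP/idP => /XY. Qed.

Lemma near_of_self B x : x \in (B : {fset R * R}) -> near_of B x.
Proof.
move=> xB; exists x => //; rewrite subrr /enorm /= expr0n addr0 sqrtr0.
by rewrite mulr_gt0.
Qed.

Lemma bad_sub X x : x \in (bad X : {fset R * R}) -> x \in (X : {fset R * R}).
Proof. by move=> /in_bad[]. Qed.

Lemma near_bad X x y : x \in (X : {fset R * R}) -> y \in (bad X : {fset R * R}) ->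
  enorm (x - y) < 2 * r -> x \in (bad X : {fset R * R}).
Proof.
move=> xX yX xy; have [->//|xy'] := eqVneq x y.
by apply/in_bad; split => //; exists y; [exact: bad_sub|rewrite xy'].
Qed.

(** A close partner of a bad point is bad too, so every bad pair survives in [bad X]. *)
Lemma bad_bad X : bad (bad X) = bad X.
Proof.
apply: fset_ext => x; split=> [/bad_sub//|xX]; apply/in_bad; split => //.
move/in_bad: (xX) => [_ [y yX xy]]; exists y => //.
by apply: near_bad xX _ => //; rewrite enormB; case/andP: xy.
Qed.

Lemma bad_mono X Y x : (forall y, y \in (X : {fset R * R}) -> y \in (Y : {fset R * R})) ->
  x \in (bad X : {fset R * R}) -> x \in (bad Y : {fset R * R}).
Proof.
move=> XY /in_bad[xX [y yX xy]]; apply/in_bad; split; first exact: XY.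
by exists y => //; exact: XY.
Qed.

(** Every point of [X] within [2 * r] of a bad point is bad. Deleting the bad points is thus a
    restriction of [X] to a region, to which independence can be applied. *)
Lemma fsetD_bad X :
  ((X : {fset R * R}) `\` bad_points r X)%fset = out (bad X) X.
Proof.
apply: fset_ext => x; rewrite in_fsetD; split.
  move=> /andP[xX xb]; apply/in_out; split => // -[y yb xy].
  by move/negP: xX; apply; exact: near_bad xy.
move=> /in_out[xX nx]; rewrite xX andbT; apply/negP => xb; apply: nx.
exact: near_of_self.
Qed.

Lemma hardP X : bad X = fset0 <-> forall x, x \notin (bad X : {fset R * R}).
Proof.
by split=> [->//|h]; apply: fset_ext => x; rewrite inE; split => // /(negP (h x)).
Qed.

Lemma hard_sub X Y : (forall y, y \in (X : {fset R * R}) -> y \in (Y : {fset R * R})) ->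
  bad Y = fset0 -> bad X = fset0.
Proof.
move=> XY /hardP hY; apply/hardP => x; apply/negP => /(bad_mono XY).
exact/negP.
Qed.

Lemma hard_out B X : bad X = fset0 -> bad (out B X) = fset0.
Proof. by apply: hard_sub => y /in_out[]. Qed.

(** Two close points of [out B X] are bad in [X], hence still present in [bad X]. So hardness away
    from [B] depends on [X] only through its bad points. *)
Lemma hard_out_bad B X : bad (out B (bad X)) = fset0 <-> bad (out B X) = fset0.
Proof.
split; last by apply: hard_sub => y /in_out[/bad_sub yX nB]; apply/in_out.
move=> /hardP h; apply/hardP => x; apply/negP => xb; move/negP: (h x); apply.
have outX y : y \in (out B X : {fset R * R}) -> y \in (X : {fset R * R}).
  by move=> /in_out[].
have xX := bad_mono outX xb.
move/in_bad: xb => [/in_out[_ xB] [y /in_out[yX yB] /andP[xy xy2]]].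
apply/in_bad; split; first exact/in_out.
exists y; last by rewrite xy.
by apply/in_out; split => //; apply: near_bad yX xX _; rewrite enormB.
Qed.

Lemma resample_regionE X : resample_region r X = near_of (bad X) `&` unit_square.
Proof.
congr (_ `&` _); apply/seteqP; split=> x.
  by move=> [y /= yb [z zr <-]]; exists y => //; rewrite addrC addKr.
move=> [y yb xy]; exists y => //; exists (x - y) => //.
by rewrite addrC subrK.
Qed.

Lemma fsetU_out_inn B X : (out B X `|` inn B X)%fset = X.
Proof.
apply: fset_ext => x; rewrite in_fsetU; split.
  by move=> /orP[/in_out[]|/in_inn[]].
move=> xX; have [xB|xB] := pselect (near_of B x); apply/orP.
  by right; apply/in_inn.
by left; apply/in_out.
Qed.

(** * Grid of side [r] and cells of the bad points *)

Definition cell (x : R * R) : int * int :=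
  (Num.floor (x.1 / r), Num.floor (x.2 / r)).

Definition region (D : {fset int * int}) : set (R * R) := [set x | cell x \in D].

Definition cells X : {fset int * int} := [fset cell x | x in (X : {fset R * R})]%fset.

(** Each coordinate differs by less than [r], so the squared distance is below [2 * r ^+ 2]. *)
Lemma same_cell x y : cell x = cell y -> enorm (x - y) < 2 * r.
Proof.
case=> e1 e2; rewrite enorm_lt2r /=.
have H (a b : R) : Num.floor (a / r) = Num.floor (b / r) -> (a - b) ^+ 2 < r ^+ 2.
  move=> e; have /andP[a1 a2] := floor_itv (a / r).
  have /andP[b1 b2] := floor_itv (b / r).
  rewrite -e in b1 b2; rewrite intrD in a2 b2.
  have ab : `|a / r - b / r| < 1 by rewrite ltr_norml; apply/andP; split; lra.
  rewrite -mulrBl normrM normfV (gtr0_norm r_gt0) ltr_pdivrMr // mul1r in ab.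
  by move: ab; rewrite ltr_norml => /andP[]; nra.
have := H _ _ e1; have := H _ _ e2.
have : 0 < r ^+ 2 by rewrite exprn_gt0.
by rewrite exprMn; nra.
Qed.

Lemma in_cells X c : c \in cells X <-> exists2 x, x \in (X : {fset R * R}) & c = cell x.
Proof. by split=> [/imfsetP[x /= xX ->]|[x xX ->]]; [exists x|apply/imfsetP; exists x]. Qed.

Lemma region_near B : region (cells B) `<=` near_of B.
Proof. by move=> x /in_cells[y yB xy]; exists y => //; exact: same_cell. Qed.

(** A point of [X] sharing a cell with a bad point is close to it, hence bad. *)
Lemma sel_region_cells_bad X : sel (region (cells (bad X))) X = bad X.
Proof.
apply: fset_ext => x; rewrite in_sel; split.
  move=> /andP[xX /set_mem /in_cells[y yb xy]].
  exact: near_bad (same_cell xy).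
move=> xb; rewrite bad_sub//=; apply/mem_set/in_cells.
by exists x.
Qed.

(** The cells of [B] lie in the neighbourhood of [B], which [out B] discards anyway. *)
Lemma out_setC_region B X : out B (sel (~` region (cells B)) X) = out B X.
Proof.
apply: fset_ext => x; split.
  by move=> /in_out[]; rewrite in_sel => /andP[xX _] xB; apply/in_out.
move=> /in_out[xX xB]; apply/in_out; split => //; rewrite in_sel xX.
by apply: mem_set => /region_near.
Qed.

(** The event is rewritten in terms of the restrictions of [X] to [region D] and to its complement.
    The conditions on [V] are split again into its part near [B] and its part away from [B], so that
    independence can be used a second time. *)
Lemma cells_badP X (D : {fset int * int})
    (B := sel (region D) X) (V := sel (~` region D) X) :
  cells (bad X) = D <->
  [/\ bad B = B, cells B = D, inn B V = fset0 & bad (out B V) = fset0].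
Proof.
split=> [eD|[bB eD iBV oBV]].
  have BX : B = bad X by rewrite /B -eD sel_region_cells_bad.
  have Vnb x : x \in (V : {fset R * R}) -> x \notin (bad X : {fset R * R}).
    rewrite in_sel => /andP[xX /set_mem xD]; apply/negP => xb; apply: xD.
    by rewrite /region /= -eD; apply/in_cells; exists x.
  have VX x : x \in (V : {fset R * R}) -> x \in (X : {fset R * R}).
    by rewrite in_sel => /andP[].
  rewrite BX bad_bad eD; split => //.
    apply: fset_ext => x; rewrite in_fset0; split => // /in_inn[xV [y yb xy]].
    by have := Vnb _ xV; rewrite (near_bad (VX _ xV) yb xy).
  apply/hardP => x; apply/negP => xb.
  have xV : x \in (V : {fset R * R}) by move/bad_sub/in_out : xb => [].
  by move/negP: (Vnb _ xV); apply; apply: bad_mono xb => y /in_out[/VX].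
suff -> : bad X = B by [].
apply: fset_ext => x; split; last first.
  rewrite -{1}bB; apply: bad_mono => y.
  by rewrite in_sel => /andP[].
(* A bad point [x] outside [D] is impossible: a partner in [D] puts [x] near [B], and a partner
   outside [D] gives a bad pair of [out B V]. *)
move=> /in_bad[xX [y yX /andP[xy xy2]]]; rewrite in_sel xX /=; apply/mem_set.
apply: contrapT => xD.
have toV z : z \in (X : {fset R * R}) -> ~ region D z -> z \in (V : {fset R * R}).
  by move=> zX zD; rewrite in_sel zX; exact: mem_set.
have nB z : z \in (V : {fset R * R}) -> ~ near_of B z.
  by move=> zV zB; have : z \in (inn B V : {fset R * R}) by [apply/in_inn]; rewrite iBV.
have xV := toV _ xX xD.
have [yD|yD] := pselect (region D y).
  by apply: (nB _ xV); exists y => //; rewrite in_sel yX mem_set.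
have yV := toV _ yX yD.
move/hardP/(_ x)/negP : oBV; apply; apply/in_bad; split.
  by apply/in_out; split => //; exact: nB.
by exists y; [apply/in_out; split => //; exact: nB|rewrite xy].
Qed.

(** * Measurability of the geometric operations *)

Lemma measurable_close d (T : measurableType d) (f g : T -> R * R) :
  measurable_fun setT f -> measurable_fun setT g ->
  measurable [set t | enorm (f t - g t) < 2 * r].
Proof.
move=> mf mg.
have m1 (h : T -> R * R) : measurable_fun setT h -> measurable_fun setT (fun t => (h t).1).
  by move=> mh; exact: (measurableT_comp measurable_fst mh).
have m2 (h : T -> R * R) : measurable_fun setT h -> measurable_fun setT (fun t => (h t).2).
  by move=> mh; exact: (measurableT_comp measurable_snd mh).
have mD : measurable_fun setT (fun t =>
    ((f t).1 - (g t).1) ^+ 2 + ((f t).2 - (g t).2) ^+ 2).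
  apply: measurable_funD; apply: measurable_funX; apply: measurable_funB.
  - exact: m1.
  - exact: m1.
  - exact: m2.
  - exact: m2.
have := measurable_fun_ltr mD (@measurable_cst _ _ T _ setT ((2 * r) ^+ 2)).
move=> /(_ measurableT [set true]); rewrite setTI => /(_ I).
by congr measurable; apply/seteqP; split => t /=; rewrite enorm_lt2r.
Qed.

Lemma measurable_near_of d (T : measurableType d) (f : T -> config R) :
  measurable_fun setT f -> measurable [set q : (R * R) * T | near_of (f q.2) q.1].
Proof.
move=> mf; apply: (@measurable_exists_point _ _ _ (fun q : (R * R) * T => f q.2)
    (fun q x => enorm (q.1 - x) < 2 * r)).
  exact: measurableT_comp.
by apply: measurable_close => //; apply: measurableT_comp => //; exact: measurable_fst.
Qed.

Lemma measurable_inn d (T : measurableType d) (f g : T -> config R) :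
  measurable_fun setT f -> measurable_fun setT g ->
  measurable_fun setT (fun t => inn (f t) (g t)).
Proof. by move=> mf mg; apply: measurable_sel => //; exact: measurable_near_of. Qed.

Lemma measurable_out d (T : measurableType d) (f g : T -> config R) :
  measurable_fun setT f -> measurable_fun setT g ->
  measurable_fun setT (fun t => out (f t) (g t)).
Proof.
by move=> mf mg; apply: measurable_sel => //; apply: measurableC; exact: measurable_near_of.
Qed.

(** The bad points are the selection of [f t] by the region of points with a distinct close
    neighbour in [f t], so [measurable_sel] applies. *)
Lemma measurable_bad d (T : measurableType d) (f : T -> config R) :
  measurable_fun setT f -> measurable_fun setT (fun t => bad (f t)).
Proof.
move=> mf; rewrite [X in measurable_fun _ X](_ : _ = fun t => sel
   [set x | exists2 y, y \in (f t : {fset R * R}) & x <> y /\ enorm (x - y) < 2 * r] (f t)).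
  apply: measurable_sel => //.
  apply: (@measurable_exists_point _ _ _ (fun q : (R * R) * T => f q.2)
    (fun q y => q.1 <> y /\ enorm (q.1 - y) < 2 * r)).
    exact: measurableT_comp.
  apply: (@measurableI _ _ (~` [set q : (R * R) * ((R * R) * T) | q.2.1 = q.1])
      [set q : (R * R) * ((R * R) * T) | enorm (q.2.1 - q.1) < 2 * r]).
    apply: measurableC; apply: measurable_point_eq => //.
    by apply: measurableT_comp => //; exact: measurable_fst.
  by apply: measurable_close => //; apply: measurableT_comp => //; exact: measurable_fst.
apply/funext => t; apply: fset_ext => x; rewrite in_sel; split.
  move=> /in_bad[-> [y yX /andP[/eqP xy xy2]]]; apply/mem_set.
  by exists y.
move=> /andP[xX /set_mem[y yX [xy xy2]]]; apply/in_bad; split => //.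
by exists y => //; rewrite xy2 andbT; apply/eqP.
Qed.

Lemma measurable_fset0 d (T : measurableType d) (f : T -> config R) :
  measurable_fun setT f -> measurable [set t | f t = fset0].
Proof.
move=> mf; rewrite [X in measurable X](_ : _ =
    f @^-1` [set X | count_in setT X = 0%N]).
  by rewrite -[X in measurable X]setTI; apply: mf => //; exact: measurable_count_eq.
apply/seteqP; split=> t /=; first by move=> ->; apply/count_in_eq0.
by move=> /count_in_eq0 h; apply: fset_ext => x; split=> [/h/(_ I)|].
Qed.

Lemma measurable_region D : measurable (region D).
Proof.
have mc (c : int * int) : measurable [set x | cell x = c].
  have m (i : int) : measurable [set a : R | Num.floor (a / r) = i].
    rewrite [X in measurable X](_ : _ = `[i%:~R * r, (i + 1)%:~R * r[%classic)//.
    apply/seteqP; split=> a /=; rewrite in_itv /= -ler_pdivlMr// -ltr_pdivrMr//.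
      by move=> <-; exact: floor_itv.
    exact: floor_def.
  rewrite [X in measurable X](_ : _ = [set a : R | Num.floor (a / r) = c.1] `*`
     [set a : R | Num.floor (a / r) = c.2]); first exact: measurableX.
  apply/seteqP; split=> -[a b] /=; rewrite /cell/=; first by move=> <-.
  by case: c => c1 c2 /= [-> ->].
rewrite [X in measurable X](_ : _ = \bigcup_(c in [set` D]) [set x | cell x = c]).
  by apply: fin_bigcup_measurable.
apply/seteqP; split=> x; first by move=> xD; exists (cell x).
by move=> [c cD /= xc]; rewrite /region /= xc.
Qed.

(** A finite combination of occupation events: every cell of [D] holds a point, and no point lies
    outside the region of [D]. *)
Lemma measurable_cells d (T : measurableType d) (f : T -> config R) D :
  measurable_fun setT f -> measurable [set t | cells (f t) = D].
Proof.
move=> mf; rewrite [X in measurable X](_ : _ =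
    \bigcap_(c in [set` D])
      [set t | exists2 x, x \in (f t : {fset R * R}) & region [fset c]%fset x]
    `&` ~` [set t | exists2 x, x \in (f t : {fset R * R}) & (~` region D) x]).
  have me A : measurable A ->
      measurable [set t | exists2 x, x \in (f t : {fset R * R}) & A x].
    move=> mA; apply: (measurable_exists_point (S := fun=> A)) => //.
    rewrite [X in measurable X](_ : _ = A `*` setT); first exact: measurableX.
    by apply/seteqP; split=> x //= [].
  apply: measurableI.
    by apply: fin_bigcap_measurable => // c _; apply: me; exact: measurable_region.
  by apply: measurableC; apply: me; apply: measurableC; exact: measurable_region.
apply/seteqP; split=> t /=.
  move=> <-; split.
    by move=> c /= /in_cells[x xf ->]; exists x => //; rewrite /region /= inE.
  by move=> [x xf]; apply; apply/in_cells; exists x.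
move=> [h1 h2]; apply/fsetP => c; apply/idP/idP.
  move=> /in_cells[x xf ->]; apply: contrapT => xD; apply: h2; exists x => //.
by move=> /h1 /= [x xf]; rewrite /region /= inE => /eqP <-; apply/in_cells; exists x.
Qed.

End bad_points_geometry.

(** * Laws determined by counts *)

Section equality_of_laws.
Context {R : realType}.
Local Open Scope ereal_scope.

(** The pushforward of [m], known afterwards only through its values and the change of variables. *)
Lemma image_measure d1 d2 (T1 : measurableType d1) (T2 : measurableType d2)
    (m : {measure set T1 -> \bar R}) (f : T1 -> T2) :
  measurable_fun setT f ->
  exists m' : {measure set T2 -> \bar R}, (forall A, m' A = m (f @^-1` A)) /\
    forall h, measurable_fun setT h -> (forall y, 0 <= h y) ->
      \int[m']_y h y = \int[m]_x h (f x).
Proof.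
move=> mf; unshelve (exists (pushforward m f)); first exact: mf.
by split => // h mh h0; rewrite ge0_integral_pushforward.
Qed.

Lemma eq_law_integral d1 d2 d (T1 : measurableType d1) (T2 : measurableType d2)
    (Y : measurableType d) (m1 : {measure set T1 -> \bar R})
    (m2 : {measure set T2 -> \bar R}) (f : T1 -> Y) (g : T2 -> Y) :
  measurable_fun setT f -> measurable_fun setT g ->
  (forall A, measurable A -> m1 (f @^-1` A) = m2 (g @^-1` A)) ->
  forall h, measurable_fun setT h -> (forall y, 0 <= h y) ->
    \int[m1]_x h (f x) = \int[m2]_x h (g x).
Proof.
move=> mf mg fg h mh h0.
have [m1' [E1 I1]] := image_measure m1 mf.
have [m2' [E2 I2]] := image_measure m2 mg.
rewrite -I1// -I2//; apply: eq_measure_integral => A mA _.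
by rewrite E1 E2 fg.
Qed.

(** Rectangles form a generating pi-system, and the total mass is finite. *)
Lemma eq_measure_prod d1 d2 (T1 : measurableType d1) (T2 : measurableType d2)
    (m m' : {measure set (T1 * T2) -> \bar R}) :
  m setT < +oo ->
  (forall A B, measurable A -> measurable B -> m (A `*` B) = m' (A `*` B)) ->
  forall C, measurable C -> m C = m' C.
Proof.
move=> moo mm'.
apply: (@measure_unique _ _ _ [set A `*` B | A in @measurable _ T1 & B in @measurable _ T2]
   (fun=> setT)) => //.
- by rewrite measurable_prod_measurableType.
- move=> _ _ [A mA [B mB <-]] [A' mA' [B' mB' <-]]; rewrite -setXI.
  by exists (A `&` A'); [exact: measurableI|exists (B `&` B') => //; exact: measurableI].
- by move=> _; exists setT => //; exists setT => //; rewrite setXTT.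
- by apply/seteqP; split => // x _; exists 0%N.
- by move=> _ [A mA [B mB <-]]; exact: mm'.
Qed.

Lemma eq_joint_law_integral d1 d2 d d' (T1 : measurableType d1)
    (T2 : measurableType d2) (Y : measurableType d) (Z : measurableType d')
    (m1 : {measure set T1 -> \bar R}) (m2 : {measure set T2 -> \bar R})
    (f : T1 -> Y * Z) (g : T2 -> Y * Z) :
  m1 setT < +oo ->
  measurable_fun setT f -> measurable_fun setT g ->
  (forall A B, measurable A -> measurable B ->
    m1 (f @^-1` (A `*` B)) = m2 (g @^-1` (A `*` B))) ->
  forall h, measurable_fun setT h -> (forall y, 0 <= h y) ->
    \int[m1]_x h (f x) = \int[m2]_x h (g x).
Proof.
move=> m1oo mf mg fg; apply: eq_law_integral => //.
have [m1' [E1 _]] := image_measure m1 mf.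
have [m2' [E2 _]] := image_measure m2 mg.
move=> A mA; rewrite -E1 -E2; apply: eq_measure_prod => //.
  by rewrite E1 preimage_setT.
by move=> B C mB mC; rewrite E1 E2 fg.
Qed.

(** An event determined by [f] is a countable disjoint union of fibres, enumerated by the codes
    [choice.pickle], some pieces being empty. *)
Lemma eq_measure_preimage d (T : measurableType d) (C : countType)
    (m m' : {measure set T -> \bar R}) (f : T -> C) :
  (forall c, measurable (f @^-1` [set c])) ->
  (forall c, m (f @^-1` [set c]) = m' (f @^-1` [set c])) ->
  forall V, m (f @^-1` V) = m' (f @^-1` V).
Proof.
move=> mf mm' V.
pose F n := [set t | V (f t) /\ choice.pickle (f t) = n].
have FE n : F n = set0 \/ exists c, F n = f @^-1` [set c].
  have [/eqP->|/set0P[t [Vt tn]]] := boolP (F n == set0); [by left|right].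
  exists (f t); apply/seteqP; split=> u /=.
    move=> [_]; rewrite -tn => /(pcan_inj choice.pickleK); exact.
  by rewrite /F /= => ->.
have mF n : measurable (F n) by case: (FE n) => [->|[c ->]].
have tF : trivIset setT F.
  by apply/trivIsetP => i j _ _ ij; apply/seteqP; split => // t [[_ ti] [_ tj]];
    move: ij; rewrite -ti -tj eqxx.
have -> : f @^-1` V = \bigcup_n F n.
  by apply/seteqP; split=> t /=; [move=> Vt; exists (choice.pickle (f t))|move=> [n _ []]].
rewrite !measure_bigcup//; apply: eq_eseriesr => n _.
by case: (FE n) => [->|[c ->]]; rewrite ?measure0.
Qed.

End equality_of_laws.

Section count_laws.
Context {R : realType}.
Local Open Scope ereal_scope.

Lemma measurable_counts (I : finType) (A : I -> set (R * R)) (k : I -> nat) :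
  (forall i, measurable (A i)) ->
  measurable ([set X | forall i, count_in (A i) X = k i] : set (config R)).
Proof.
move=> mA; rewrite [X in measurable X](_ : _ =
   \bigcap_(i in [set: I]) [set X | count_in (A i) X = k i]); last first.
  by apply/seteqP; split=> X /= XA i; [move=> _|]; exact: XA.
by apply: fin_bigcap_measurable => // i _; exact: measurable_count_eq.
Qed.

(** Count events of disjoint families are not visibly closed under intersection. The proof enlarges
    them to arbitrary finite families, which form a pi-system, and reduces these to disjoint ones
    through the atoms of the family. *)
Lemma eq_measure_counts (m m' : {measure set (config R) -> \bar R}) :
  m setT < +oo ->
  (forall (n : nat) (A : 'I_n -> set (R * R)) (k : 'I_n -> nat),
    (forall i, measurable (A i)) -> trivIset setT A ->
    m [set X | forall i, count_in (A i) X = k i] =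
    m' [set X | forall i, count_in (A i) X = k i]) ->
  forall E, measurable E -> m E = m' E.
Proof.
move=> moo mm'.
pose G : set (set (config R)) := [set C | exists (I : finType)
  (A : I -> set (R * R)) (k : I -> nat), (forall i, measurable (A i)) /\
  C = [set X | forall i, count_in (A i) X = k i]].
have GT : G setT.
  exists 'I_0, (fun=> set0), (fun=> 0%N); split => //.
  by apply/seteqP; split=> // X _ [].
suff H E : <<s G >> E -> m E = m' E.
  move=> E mE; apply: H; move: E mE; apply: sub_sigma_algebra2.
  move=> _ [A [k [mA ->]]].
  exists unit, (fun=> A), (fun=> k); split => //.
  by apply/seteqP; split=> X //= /(_ tt).
apply: (@g_sigma_algebra_measure_unique _ _ _ G _ (fun=> setT)) => //.
- by move=> _ [I [A [k [mA ->]]]]; exact: measurable_counts.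
- by apply/seteqP; split => // x _; exists 0%N.
- move=> _ _ [I [A [k [mA ->]]]] [J [B [l [mB ->]]]].
  exists (I + J)%type, (fun i => match i with inl i => A i | inr j => B j end),
    (fun i => match i with inl i => k i | inr j => l j end); split; first by case.
  apply/seteqP; split=> X /=; first by move=> [XA XB] [].
  by move=> XAB; split=> [i|j]; [exact: (XAB (inl i))|exact: (XAB (inr j))].
- move=> _ [I [A [k [mA ->]]]].
  (* [sig x] records which of the [A i] contain [x]; its level sets, the atoms, partition the
     plane. *)
  pose sig x : {set I} := finset (fun i => x \in A i).
  pose atom (s : {set I}) := [set x | sig x = s].
  have matom s : measurable (atom s).
    rewrite [X in measurable X](_ : _ = \bigcap_(i in [set: I])
        (if i \in s then A i else ~` A i)).
      apply: fin_bigcap_measurable => // i _.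
      by case: ifP => _; [exact: mA|exact: measurableC].
    apply/seteqP; split=> x /=.
      by move=> <- i _; rewrite inE; case: ifPn => [/set_mem//|]; rewrite notin_setE.
    move=> xA; apply/setP => i; have := xA i Logic.I; rewrite inE.
    by case: ifP => _ Ax; [exact: mem_set|rewrite memNset].
  pose c (X : config R) : {ffun {set I} -> nat} := [ffun s => count_in (atom s) X].
  have cE v : c @^-1` [set v] = [set X | forall s, count_in (atom s) X = v s].
    apply/seteqP; split=> X /=; first by move=> <- s; rewrite ffunE.
    by move=> h; apply/ffunP => s; rewrite ffunE.
  (* The count in [A i] is the sum of the counts in the atoms that it contains. The event is thus
     determined by the vector [c X], which takes countably many values. *)
  have countA X i : count_in (A i) X = (\sum_(s : {set I} | i \in s) c X s)%N.
    have H (P : pred (R * R)) : #|` [fset x in (X : {fset R * R}) | P x]%fset | =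
        (\sum_(x <- (X : {fset R * R})) P x)%N.
      by rewrite card_fset_sum1 big_fset big_mkcond; apply: eq_bigr => x _; case: (P x).
    rewrite /count_in H; under [in RHS]eq_bigr do rewrite ffunE /count_in H.
    rewrite exchange_big /=; apply: eq_bigr => x _.
    rewrite -big_mkcondr /= sum1_card.
    rewrite (eq_card (B := [pred s | (s == sig x) && (i \in s)])); last first.
      move=> s; rewrite !inE andbC; congr (_ && _); apply/idP/eqP => [/set_mem<-//|->].
      exact: mem_set.
    case: (boolP (x \in A i)) => xA.
      rewrite (eq_card (B := pred1 (sig x))) ?card1 // => s; rewrite !inE.
      by case: eqP => // ->; rewrite inE.
    rewrite eq_card0// => s; rewrite !inE; case: eqP => // ->.
    by rewrite inE (negbTE xA).
  have -> : [set X | forall i, count_in (A i) X = k i] =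
      c @^-1` [set v | forall i, (\sum_(s : {set I} | i \in s) v s)%N = k i].
    by apply/seteqP; split=> X /= h i; [rewrite -countA|rewrite countA].
  apply: eq_measure_preimage => v; rewrite cE; first exact: measurable_counts.
  have -> : [set X | forall s, count_in (atom s) X = v s] =
     [set X | forall i : 'I_#|{: {set I}}|,
        count_in (atom (enum_val i)) X = v (enum_val i)].
    apply/seteqP; split=> X /= h s; first exact: h.
    by have := h (enum_rank s); rewrite enum_rankK.
  apply: mm' => [i|]; first exact: matom.
  apply/trivIsetP => i j _ _ /eqP ij; apply/seteqP; split => // x [/= xi xj].
  by apply: ij; apply: enum_val_inj; rewrite -xi -xj.
Qed.

End count_laws.

(** * Poisson processes *)

Section poisson_process.
Context {R : realType} (lam : R) (S : set (R * R)).
Local Open Scope ereal_scope.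

Lemma measurable_sel_cst (A : set (R * R)) : measurable A ->
  measurable_fun setT (sel A : config R -> config R).
Proof.
move=> mA; apply: (@measurable_sel _ _ _ id (fun=> A)) => //.
rewrite [X in measurable X](_ : _ = A `*` setT); first exact: measurableX.
by apply/seteqP; split=> x //= [].
Qed.

Lemma poisson_process_unique (m m' : {measure set (config R) -> \bar R}) :
  is_poisson_process lam S m -> is_poisson_process lam S m' ->
  forall E, measurable E -> m E = m' E.
Proof.
move=> pm pm'; apply: eq_measure_counts => [|n A k mA tA]; last by rewrite pm// pm'.
(* The empty family gives the total mass: an empty product, equal to 1. *)
have := pm 0%N (fun=> set0) (fun=> 0%N).
rewrite big_ord0 (_ : [set X | _] = setT); last by apply/seteqP; split => // X _ [].
by move=> ->//; rewrite ?ltry//; apply/trivIsetP => -[].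
Qed.

Lemma poisson_process_sel (m m' : {measure set (config R) -> \bar R}) A :
  measurable A -> is_poisson_process lam S m ->
  (forall E, m' E = m (sel A @^-1` E)) -> is_poisson_process lam (A `&` S) m'.
Proof.
move=> mA pm m'E n B k mB tB; rewrite m'E.
have -> : sel A @^-1` [set X | forall i, count_in (B i) X = k i] =
    [set X | forall i, count_in (B i `&` A) X = k i].
  by apply/seteqP; split=> X /= h i; have := h i; rewrite count_in_sel.
rewrite pm.
- by apply: eq_bigr => i _; rewrite setIA.
- by move=> i; exact: measurableI.
- by apply: trivIset_setIr.
Qed.

(** The total count is Poisson, or Dirac at 0 when the rate is not positive; both laws charge 0.
    This will make the normalizing constants positive. *)
Lemma poisson_process_void (m : {measure set (config R) -> \bar R}) :
  is_poisson_process lam S m -> 0 < m [set fset0].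
Proof.
move=> pm; have := pm 1%N (fun=> setT) (fun=> 0%N).
rewrite big_ord1 (_ : [set X | _] = [set fset0]); last first.
  apply/seteqP; split => X /=.
    move=> /(_ ord0) /count_in_eq0 X0; apply: fset_ext => x; rewrite in_fset0.
    by split => // /X0 /(_ Logic.I).
  by move=> -> i; apply/count_in_eq0.
move=> ->//; last by apply/trivIsetP => i j; rewrite !ord1 eqxx.
rewrite /poisson_prob; case: ifPn => h; last by rewrite diracE mem_set // lte01.
rewrite esum_set1 /poisson_pmf h ?lee_fin ?lte_fin expr0 fact0 invr1 !mul1r.
  exact: expR_gt0.
exact: expR_ge0.
Qed.

End poisson_process.

(** * Independence of the restrictions to a set and to its complement *)

Section poisson_independence.
Context {R : realType} (lam : R) (S : set (R * R)).
Variable Pi : probability (config R) R.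
Hypothesis pPi : is_poisson_process lam S Pi.
Local Open Scope ereal_scope.

Lemma measurable_preimage d1 d2 (T1 : measurableType d1) (T2 : measurableType d2)
  (f : T1 -> T2) (A : set T2) : measurable_fun setT f -> measurable A ->
  measurable (f @^-1` A).
Proof. by move=> mf mA; rewrite -[X in measurable X]setTI; exact: mf. Qed.

(** For count events this is the product formula defining the Poisson process. It extends to all
    events one side at a time, by [eq_measure_counts] for a restricted and a scaled measure. *)
Lemma poisson_indep (A : set (R * R)) (E F : set (config R)) : measurable A ->
  measurable E -> measurable F ->
  Pi (sel A @^-1` E `&` sel (~` A) @^-1` F) =
  Pi (sel A @^-1` E) * Pi (sel (~` A) @^-1` F).
Proof.
move=> mA mE mF.
have mCA : measurable (~` A) by exact: measurableC.
have [mu1 [mu1E _]] := image_measure Pi (measurable_sel_cst mA).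
have [mu2 [mu2E _]] := image_measure Pi (measurable_sel_cst mCA).
have pmu1 := poisson_process_sel mA pPi mu1E.
have pmu2 := poisson_process_sel mCA pPi mu2E.
have restrict_measure B C : measurable B -> measurable C ->
    exists m : {measure set (config R) -> \bar R}, forall G, m G =
      Pi (sel C @^-1` G `&` B).
  move=> mB mC; have [m [mP _]] := image_measure (mrestr Pi mB) (measurable_sel_cst mC).
  by exists m.
have scale_measure B C : measurable B -> measurable C ->
    exists m : {measure set (config R) -> \bar R}, forall G, m G =
      Pi B * Pi (sel C @^-1` G).
  move=> mB mC; have [m [mP _]] := image_measure Pi (measurable_sel_cst mC).
  have r0 : (0 <= fine (Pi B))%R by rewrite fine_ge0.
  exists (mscale (NngNum r0) m) => G.
  rewrite -[LHS]/(mscale (NngNum r0) m G) /mscale mP /= fineK//.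
  exact: fin_num_measure.
have Pi_fin B : measurable B -> Pi B < +oo.
  by move=> mB; rewrite (le_lt_trans (probability_le1 _ _))// ltry.
have counts n (B : 'I_n -> set (R * R)) k p (C : 'I_p -> set (R * R)) l :
    (forall i, measurable (B i)) -> trivIset setT B ->
    (forall i, measurable (C i)) -> trivIset setT C ->
    Pi (sel A @^-1` [set X | forall i, count_in (B i) X = k i] `&`
        sel (~` A) @^-1` [set X | forall i, count_in (C i) X = l i]) =
    Pi (sel A @^-1` [set X | forall i, count_in (B i) X = k i]) *
    Pi (sel (~` A) @^-1` [set X | forall i, count_in (C i) X = l i]).
  move=> mB tB mC tC; rewrite -mu1E -mu2E pmu1// pmu2//.
  (* Cutting the first family with [A] and the second with its complement merges them into one
     disjoint family. *)
  pose D (i : 'I_(n + p)) :=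
    match fintype.split i with inl j => B j `&` A | inr j => C j `&` ~` A end.
  pose q (i : 'I_(n + p)) := match fintype.split i with inl j => k j | inr j => l j end.
  have -> : sel A @^-1` [set X | forall i, count_in (B i) X = k i] `&`
        sel (~` A) @^-1` [set X | forall i, count_in (C i) X = l i] =
      [set X | forall i, count_in (D i) X = q i].
    apply/seteqP; split=> X /=.
      move=> [h1 h2] i; rewrite /D /q; case: fintype.split => j.
        by rewrite -count_in_sel; exact: h1.
      by rewrite -count_in_sel; exact: h2.
    move=> h; split=> i; rewrite count_in_sel.
      by have := h (lshift p i); rewrite /D /q (unsplitK (inl i)).
    by have := h (rshift n i); rewrite /D /q (unsplitK (inr i)).
  rewrite pPi.
  - rewrite big_split_ord /=; congr (_ * _); apply: eq_bigr => i _.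
      by rewrite /D /q (unsplitK (inl i)) setIA.
    by rewrite /D /q (unsplitK (inr i)) setIA.
  - by move=> i; rewrite /D; case: fintype.split => j; exact: measurableI.
  - apply/trivIsetP => i j _ _ ij.
    have : fintype.split i <> fintype.split j.
      by move=> /(can_inj (@splitK _ _)) /eqP; rewrite (negbTE ij).
    rewrite /D; case: fintype.split => i'; case: fintype.split => j' ij'.
    + move/trivIsetP: tB => /(_ i' j' Logic.I Logic.I) tB.
      rewrite setIACA tB ?set0I//; apply/eqP => ij''; apply: ij'; congr inl; exact: ij''.
    + by rewrite setIACA setICr setI0.
    + by rewrite setIACA (setIC (~` A)) setICr setI0.
    + move/trivIsetP: tC => /(_ i' j' Logic.I Logic.I) tC.
      rewrite setIACA tC ?set0I//; apply/eqP => ij''; apply: ij'; congr inr; exact: ij''.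
(* First the event on the complement becomes the arbitrary [F], the event on [A] remaining a count
   event; afterwards [E] is freed in the same way. *)
have step n (B : 'I_n -> set (R * R)) k (G := [set X | forall i, count_in (B i) X = k i]) :
    (forall i, measurable (B i)) -> trivIset setT B ->
    Pi (sel (~` A) @^-1` F `&` sel A @^-1` G) =
    Pi (sel A @^-1` G) * Pi (sel (~` A) @^-1` F).
  move=> mB tB.
  have mG : measurable (sel A @^-1` G : set (config R)).
    by apply: measurable_preimage; [exact: measurable_sel_cst|exact: measurable_counts].
  have [m1 m1E] := restrict_measure _ _ mG mCA.
  have [m2 m2E] := scale_measure _ _ mG mCA.
  rewrite -m1E -m2E; apply: eq_measure_counts mF => [|p C l mC tC].
    by rewrite m1E preimage_setT setTI Pi_fin.
  by rewrite m1E m2E setIC counts.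
have mF' : measurable (sel (~` A) @^-1` F : set (config R)).
  by apply: measurable_preimage; [exact: measurable_sel_cst|].
have [m1 m1E] := restrict_measure _ _ mF' mA.
have [m2 m2E] := scale_measure _ _ mF' mA.
rewrite -m1E muleC -m2E; apply: eq_measure_counts mE => [|p C l mC tC].
  by rewrite m1E preimage_setT setTI Pi_fin.
by rewrite m1E m2E setIC step// muleC.
Qed.

(** Functional form of independence: the two restrictions of one sample have the joint law of
    restrictions of two independent samples, by comparison on rectangles. *)
Lemma poisson_indep_integral (A : set (R * R)) (h : config R * config R -> \bar R) :
  measurable A -> measurable_fun setT h -> (forall p, 0 <= h p) ->
  \int[Pi]_X h (sel A X, sel (~` A) X) =
  \int[Pi]_X \int[Pi]_Y h (sel A X, sel (~` A) Y).
Proof.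
move=> mA mh h0.
have mCA : measurable (~` A) by exact: measurableC.
have ms : measurable_fun setT
    (fun p : config R * config R => (sel A p.1, sel (~` A) p.2)).
  exact: (measurable_fun_pair
    (measurableT_comp (measurable_sel_cst mA) measurable_config_fst)
    (measurableT_comp (measurable_sel_cst mCA) measurable_config_snd)).
rewrite -(fubini_tonelli1 (fun p => h (sel A p.1, sel (~` A) p.2)))//; last first.
  exact: measurableT_comp mh ms.
apply: (@eq_joint_law_integral _ _ _ _ _ _ _ _ _ Pi (Pi \x Pi)
  (fun X => (sel A X, sel (~` A) X))
  (fun p : config R * config R => (sel A p.1, sel (~` A) p.2))) => //.
- by rewrite (le_lt_trans (probability_le1 _ _))// ltry.
- by apply: measurable_fun_pair; exact: measurable_sel_cst.
- move=> E F mE mF.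
  have mE' : measurable (sel A @^-1` E : set (config R)).
    by apply: measurable_preimage; [exact: measurable_sel_cst|].
  have mF' : measurable (sel (~` A) @^-1` F : set (config R)).
    by apply: measurable_preimage; [exact: measurable_sel_cst|].
  rewrite (_ : _ @^-1` _ = (sel A @^-1` E) `*` (sel (~` A) @^-1` F)); last first.
    by apply/seteqP; split=> p [].
  apply: etrans (esym (product_measure1E Pi Pi mE' mF')).
  exact: poisson_indep.
Qed.

End poisson_independence.

(** * Conditional law given the bad points *)

Section integral_fibers.
Context {R : realType} d (T : measurableType d) (m : {measure set T -> \bar R}).
Local Open Scope ereal_scope.

(** It will be applied to the cells of the bad points, whose countably many values take the place of
    a conditioning on the bad points. *)
Lemma eq_integral_fibers (C : countType) (c : T -> C) (g1 g2 : T -> \bar R) :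
  (forall v, measurable (c @^-1` [set v])) ->
  measurable_fun setT g1 -> measurable_fun setT g2 ->
  (forall x, 0 <= g1 x) -> (forall x, 0 <= g2 x) ->
  (forall v, \int[m]_(x in c @^-1` [set v]) g1 x =
             \int[m]_(x in c @^-1` [set v]) g2 x) ->
  \int[m]_x g1 x = \int[m]_x g2 x.
Proof.
move=> mc mg1 mg2 g10 g20 g12.
pose F n := [set t | choice.pickle (c t) = n].
have FE n : F n = set0 \/ exists v, F n = c @^-1` [set v].
  have [/eqP->|/set0P[t tn]] := boolP (F n == set0); [by left|right].
  exists (c t); apply/seteqP; split=> u /=.
    by rewrite -tn => /(pcan_inj choice.pickleK).
  by rewrite /F /= => ->.
have mF n : measurable (F n) by case: (FE n) => [->|[v ->]].
have tF : trivIset setT F.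
  by apply/trivIsetP => i j _ _ ij; apply/seteqP; split => // t [ti tj];
    move: ij; rewrite -ti -tj eqxx.
have FT : \bigcup_n F n = setT.
  by apply/seteqP; split=> // t _; exists (choice.pickle (c t)).
rewrite -FT !ge0_integral_bigcup//; last 2 first.
- by rewrite FT.
- by rewrite FT.
apply: eq_eseriesr => n _.
by case: (FE n) => [->|[v ->]] //; rewrite !integral_set0.
Qed.

End integral_fibers.

Section exchange.
Context {R : realType} (lam r : R) (S : set (R * R)).
Hypothesis r_gt0 : (0 < r)%R.
Variable Pi : probability (config R) R.
Hypothesis pPi : is_poisson_process lam S Pi.
Local Open Scope ereal_scope.
Notation bad := (bad r).
Notation inn := (inn r).
Notation out := (out r).

Definition hard_ind (X : config R) : \bar R :=
  (\1_([set X | bad X = fset0] : set (config R)) X)%:E.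

Lemma hard_ind_ge0 X : 0 <= hard_ind X.
Proof. by rewrite lee_fin. Qed.

Lemma measurable_indE d (T : measurableType d) (A : set T) :
  measurable A -> measurable_fun setT (fun x => (\1_A x : R)%:E).
Proof. by move=> mA; apply/measurable_EFinP; exact: measurable_indic. Qed.

Lemma measurable_hard_ind d (T : measurableType d) (f : T -> config R) :
  measurable_fun setT f -> measurable_fun setT (fun t => hard_ind (f t)).
Proof.
move=> mf; apply: (@measurableT_comp _ _ _ _ _ _ hard_ind) => //.
by apply: measurable_indE; apply: measurable_fset0; exact: measurable_bad.
Qed.

Lemma measurable_integral d (T : measurableType d) (g : T -> config R -> \bar R) :
  measurable_fun setT (fun p : T * config R => g p.1 p.2) ->
  (forall x y, 0 <= g x y) -> measurable_fun setT (fun x => \int[Pi]_y g x y).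
Proof.
move=> mg g0.
exact: (measurable_fun_fubini_tonelli_F (fun p : T * config R => g p.1 p.2)).
Qed.

Lemma measurable_near_of_cst (B : config R) : measurable (near_of r B).
Proof.
have := measurable_near_of r_gt0 (@measurable_cst _ _ (config R) (config R) setT B).
move=> /(measurable_ysection (B : config R)); congr measurable.
by apply/seteqP; split=> x; rewrite /ysection /= inE.
Qed.

Lemma near_of_indep (B : config R) (h : config R * config R -> \bar R) :
  measurable_fun setT h -> (forall p, 0 <= h p) ->
  \int[Pi]_X h (inn B X, out B X) = \int[Pi]_X \int[Pi]_Y h (inn B X, out B Y).
Proof.
move=> mh h0; apply: (poisson_indep_integral pPi) => //.
exact: measurable_near_of_cst.
Qed.

(** By [cells_badP] the event only involves the restrictions to [region r D] and to its complement,
    which separate into [X] and [Y]. With [B] fixed by the first, splitting [Y] at the neighbourhood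
    of [B] gives two factors: no point near [B] outside [D], and hardness away from [B]. *)
Lemma integral_cells_bad D (phi : config R * config R -> \bar R) :
  measurable_fun setT phi -> (forall p, 0 <= phi p) ->
  \int[Pi]_(X in [set X | cells r (bad X) = D]) phi (bad X, out (bad X) X) =
  \int[Pi]_X ((\1_[set B : config R | bad B = B /\ cells r B = D] (sel (region r D) X))%:E *
    ((\int[Pi]_Y (\1_([set fset0] : set (config R))
        (sel (~` region r D) (inn (sel (region r D) X) Y)))%:E) *
    \int[Pi]_Y (hard_ind (out (sel (region r D) X) Y) *
        phi (sel (region r D) X, out (sel (region r D) X) Y)))).
Proof.
move=> mphi phi0; rewrite integral_mkcond.
pose kap := [set B : config R | bad B = B /\ cells r B = D].
have mkap : measurable kap.
  apply: (@measurableI _ _ [set B | bad B = B] [set B | cells r B = D]); last first.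
    exact: measurable_cells.
  have mb := @measurable_bad _ _ r_gt0 _ (config R) id (@measurable_id _ _ _).
  (* All points of [B] are bad exactly when none lies away from the bad ones; an equality of
     configurations becomes the emptiness of one. *)
  rewrite [X in measurable X](_ : _ = [set B | out (bad B) B = fset0]).
    by apply: measurable_fset0; apply: measurable_out.
  apply/seteqP; split=> B /=.
    move=> BB; apply: fset_ext => x; rewrite in_fset0; split => // /in_out[xB]; case.
    by apply: near_of_self => //; rewrite BB.
  rewrite -fsetD_bad// => /eqP; rewrite fsetD_eq0 => /fsubsetP BB.
  by apply: fset_ext => x; split=> [/bad_sub|/BB].
have m0 : measurable ([set fset0] : set (config R)) by exact: measurable_fset0.
pose h (p : config R * config R) := (\1_kap p.1)%:E *
  ((\1_([set fset0] : set (config R)) (inn p.1 p.2))%:E *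
   (hard_ind (out p.1 p.2) * phi (p.1, out p.1 p.2))).
have mout : measurable_fun setT (fun p : config R * config R => out p.1 p.2).
  exact: (measurable_out r_gt0 measurable_config_fst measurable_config_snd).
have minn : measurable_fun setT (fun p : config R * config R => inn p.1 p.2).
  exact: (measurable_inn r_gt0 measurable_config_fst measurable_config_snd).
have mh : measurable_fun setT h.
  apply: emeasurable_funM.
    exact: (measurableT_comp (measurable_indE mkap) measurable_config_fst).
  apply: emeasurable_funM; first exact: (measurableT_comp (measurable_indE m0)).
  apply: emeasurable_funM; first exact: measurable_hard_ind.
  exact: (measurableT_comp mphi (measurable_fun_pair measurable_config_fst mout)).
have h0 p : 0 <= h p by rewrite /h !mule_ge0 ?lee_fin.
transitivity (\int[Pi]_X h (sel (region r D) X, sel (~` region r D) X)).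
  apply: eq_integral => X _; rewrite patchE /h /=.
  case: (boolP (X \in _)) => [/set_mem /= eD|/negP XD].
    have /(cells_badP r_gt0)[bB cB iB oB] := eD.
    have BX : sel (region r D) X = bad X by rewrite -eD sel_region_cells_bad.
    rewrite /hard_ind !indicE !mem_set ?mul1e//.
    by rewrite BX -eD out_setC_region.
  rewrite /hard_ind !indicE.
  case: (boolP (_ \in kap)) => [/set_mem[/= bB cB]|]; last by rewrite mul0e.
  case: (boolP (_ \in [set fset0])) => [/set_mem/= iB|]; last by rewrite mul0e mule0.
  case: (boolP (_ \in [set X | bad X = fset0])) => [/set_mem/= oB|]; last first.
    by rewrite mul0e !mule0.
  by exfalso; apply: XD; apply/mem_set/(cells_badP r_gt0).
rewrite (poisson_indep_integral pPi)//; last exact: measurable_region.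
apply: eq_integral => X _; rewrite /h /=; set B := sel _ X.
case: (boolP (B \in kap)) => [/set_mem[bB cB]|nB]; last first.
  rewrite !indicE (negbTE nB) mul0e; under eq_integral do rewrite mul0e.
  by rewrite integral0.
rewrite !indicE mem_set// mul1e.
(* With [B] fixed, [h2] is to be applied to the parts of [Y] near [B] and away from [B]. *)
pose h2 (p : config R * config R) :=
  (\1_([set fset0] : set (config R)) (sel (~` region r D) p.1))%:E *
  (hard_ind p.2 * phi (B, p.2)).
have mR : measurable (~` region r D) by apply: measurableC; exact: measurable_region.
have mphiB : measurable_fun setT (fun p : config R => phi (B, p)).
  by apply: (measurableT_comp mphi); exact: measurable_fun_pair.
have mh2 : measurable_fun setT h2.
  apply: emeasurable_funM.
    apply: (measurableT_comp (measurable_indE m0)).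
    exact: (measurableT_comp (measurable_sel_cst mR) measurable_config_fst).
  apply: emeasurable_funM; first exact: (measurable_hard_ind measurable_config_snd).
  exact: (measurableT_comp mphiB measurable_config_snd).
have h20 p : 0 <= h2 p by rewrite /h2 !mule_ge0 ?lee_fin.
have moutB : measurable_fun setT (fun Y => out B Y) by exact: measurable_out.
have minnB : measurable_fun setT (fun Y => inn B Y) by exact: measurable_inn.
transitivity (\int[Pi]_Y h2 (inn B Y, out B Y)).
  apply: eq_integral => Y _; rewrite mul1e /h2 /=.
  rewrite -cB out_setC_region//; congr (((\1__ _)%:E) * _).
  by apply: fset_ext => x; rewrite !in_sel andbAC.
rewrite near_of_indep// /h2 /=.
rewrite -ge0_integralZr//; last 2 first.
- apply: (measurableT_comp (measurable_indE m0)).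
  exact: (measurableT_comp (measurable_sel_cst mR)).
- by apply: integral_ge0 => Y _; rewrite mule_ge0 ?hard_ind_ge0.
apply: eq_integral => Y _; rewrite ge0_integralZl//.
- apply: emeasurable_funM; first exact: measurable_hard_ind.
  exact: (measurableT_comp mphiB).
- by move=> Z _; rewrite mule_ge0 ?hard_ind_ge0. 
Qed.

(** The normalizing constant of the hard disks law away from [B]. *)
Definition hard_prob (B : config R) : \bar R := \int[Pi]_Y hard_ind (out B Y).

Lemma measurable_hard_prob : measurable_fun setT hard_prob.
Proof.
apply: measurable_integral => [|x y]; last exact: hard_ind_ge0.
apply: measurable_hard_ind.
exact: (measurable_out r_gt0 measurable_config_fst measurable_config_snd).
Qed.

Lemma hard_prob_ge0 B : 0 <= hard_prob B.
Proof. by apply: integral_ge0 => Y _; exact: hard_ind_ge0. Qed.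

(** The conditional law given the bad points, cleared of denominators: the rest of [X] is exchanged
    for an independent sample that is hard away from [bad X], and [hard_prob] stays on the other
    side. *)
Lemma bad_points_exchange (psi : config R * config R -> \bar R) :
  measurable_fun setT psi -> (forall p, 0 <= psi p) ->
  \int[Pi]_X (hard_prob (bad X) * psi (bad X, out (bad X) X)) =
  \int[Pi]_X \int[Pi]_Y (hard_ind (out (bad X) Y) * psi (bad X, out (bad X) Y)).
Proof.
move=> mpsi psi0.
pose M B := \int[Pi]_Y (hard_ind (out B Y) * psi (B, out B Y)).
have mout : measurable_fun setT (fun p : config R * config R => out p.1 p.2).
  exact: (measurable_out r_gt0 measurable_config_fst measurable_config_snd).
have M0 B : 0 <= M B.
  by apply: integral_ge0 => Y _; rewrite mule_ge0 ?hard_ind_ge0.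
have mM : measurable_fun setT M.
  apply: measurable_integral => [|x y]; last by rewrite mule_ge0 ?hard_ind_ge0.
  apply: emeasurable_funM; first exact: (measurable_hard_ind mout).
  exact: (measurableT_comp mpsi (measurable_fun_pair measurable_config_fst mout)).
have mbad : measurable_fun setT (bad : config R -> config R) by exact: measurable_bad.
have moutb : measurable_fun setT (fun X : config R => out (bad X) X).
  exact: measurable_out.
apply: (@eq_integral_fibers _ _ _ Pi _ (fun X => cells r (bad X))).
- by move=> D; exact: measurable_cells.
- apply: emeasurable_funM; first exact: (measurableT_comp measurable_hard_prob).
  by apply: (measurableT_comp mpsi); exact: measurable_fun_pair.
- exact: (measurableT_comp mM).
- by move=> X; rewrite mule_ge0 ?hard_prob_ge0.
- by move=> X; exact: M0.
move=> D.
have := @integral_cells_bad D (fun p => hard_prob p.1 * psi p).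
rewrite /= => ->; last 2 first.
- apply: emeasurable_funM => //; 
  exact: (measurableT_comp measurable_hard_prob measurable_config_fst).
- by move=> p; rewrite mule_ge0 ?hard_prob_ge0.
have := @integral_cells_bad D (fun p => M p.1).
rewrite /= => ->; last 2 first.
- exact: (measurableT_comp mM measurable_config_fst).
- by move=> p; exact: M0.
(* The first two factors are the same, and the third is [hard_prob B * M B] on both sides. *)
apply: eq_integral => X _; congr (_ * (_ * _)); set B := sel _ X.
have moutB : measurable_fun setT (fun Y => out B Y) by exact: measurable_out.
under eq_integral do rewrite muleCA.
rewrite ge0_integralZl//; last 3 first.
- apply: emeasurable_funM; first exact: measurable_hard_ind.
  by apply: (measurableT_comp mpsi); exact: measurable_fun_pair.
- by move=> Y _; rewrite mule_ge0 ?hard_ind_ge0.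
- exact: hard_prob_ge0.
rewrite ge0_integralZr//; first exact: measurable_hard_ind.
by move=> Y _; exact: hard_ind_ge0.
Qed.

(** The parts of a sample near [B] and away from [B] are independent, so the near part may be drawn
    afresh; the indicator only looks at the far part. *)
Lemma out_inn_superposition (B : config R) (h : config R -> \bar R) :
  measurable_fun setT h -> (forall X, 0 <= h X) ->
  \int[Pi]_Y (hard_ind (out B Y) * \int[Pi]_Z h (out B Y `|` inn B Z)%fset) =
  \int[Pi]_Y (hard_ind (out B Y) * h Y).
Proof.
move=> mh h0.
pose h3 (p : config R * config R) := hard_ind p.2 * h (p.2 `|` p.1)%fset.
have mU : measurable_fun setT
    (fun p : config R * config R => (p.2 `|` p.1)%fset : config R).
  exact: (measurable_fsetU measurable_config_snd measurable_config_fst).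
have mh3 : measurable_fun setT h3.
  apply: emeasurable_funM.
    exact: (measurable_hard_ind measurable_config_snd).
  exact: (measurableT_comp mh mU).
have h30 p : 0 <= h3 p by rewrite mule_ge0 ?hard_ind_ge0.
transitivity (\int[Pi]_Y h3 (inn B Y, out B Y)); last first.
  by apply: eq_integral => Y _; rewrite /h3 /= fsetU_out_inn.
have moutB : measurable_fun setT (fun Y => out B Y) by exact: measurable_out.
have minnB : measurable_fun setT (fun Y => inn B Y) by exact: measurable_inn.
rewrite near_of_indep//.
rewrite (fubini_tonelli (fun p : config R * config R => h3 (inn B p.1, out B p.2)))//.
  apply: eq_integral => Y _; rewrite /h3 /= ge0_integralZl ?hard_ind_ge0//.
  apply: (measurableT_comp mh).
  exact: (measurable_fsetU (@measurable_cst _ _ (config R) (config R) setT _) minnB).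
exact: (measurableT_comp mh3 (measurable_fun_pair
  (measurableT_comp minnB measurable_config_fst)
  (measurableT_comp moutB measurable_config_snd))).
Qed.

End exchange.

(** * One round of the algorithm *)

Section one_round.
Context {R : realType} (lam r : R) (S : set (R * R)).
Hypothesis r_gt0 : (0 < r)%R.
Variable Pi : probability (config R) R.
Hypothesis pPi : is_poisson_process lam S Pi.
Local Open Scope ereal_scope.
Notation bad := (bad r).
Notation inn := (inn r).
Notation out := (out r).
Notation hard_prob := (hard_prob r Pi).

Definition bad_ind (X : config R) : \bar R :=
  (\1_(~` [set X | bad X = fset0] : set (config R)) X)%:E.

Lemma bad_ind_ge0 X : 0 <= bad_ind X.
Proof. by rewrite lee_fin. Qed.

Lemma measurable_bad_ind : measurable_fun setT bad_ind.
Proof.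
apply: measurable_indE; apply: measurableC.
by apply: measurable_fset0; exact: measurable_bad.
Qed.

Lemma bad_ind_bad X : bad_ind (bad X) = bad_ind X.
Proof.
rewrite /bad_ind !indicE; congr (_ %:R%:E); congr nat_of_bool.
by apply/idP/idP; rewrite !inE /= bad_bad.
Qed.

(** The empty configuration is hard and has positive probability. *)
Lemma hard_prob_gt0 B : 0 < hard_prob B.
Proof.
apply: lt_le_trans (poisson_process_void pPi) _.
have m0 : measurable ([set fset0] : set (config R)).
  exact: (@measurable_fset0 _ _ (config R) id).
rewrite [leLHS](_ : _ = \int[Pi]_X (\1_([set fset0] : set (config R)) X)%:E); last first.
  by rewrite integral_indic// setIT.
apply: ge0_le_integral => //.
- exact: measurable_indE.
- by apply: measurable_hard_ind => //; exact: measurable_out.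
- move=> X _; rewrite lee_fin !indicE; case: (boolP (X \in _)) => [/set_mem /= ->|//].
  rewrite mem_set//=; apply/hard_out/hardP => x; apply/negP => /bad_sub.
  by rewrite in_fset0.
Qed.

Lemma hard_prob_fin B : hard_prob B \is a fin_num.
Proof.
rewrite ge0_fin_numE ?hard_prob_ge0// (@le_lt_trans _ _ 1) ?ltry//.
rewrite -[leRHS](@probability_setT _ _ _ Pi) -[leRHS]mul1e -integral_cst//.
apply: ge0_le_integral => //.
- by move=> X _; exact: hard_ind_ge0.
- by apply: measurable_hard_ind => //; exact: measurable_out.
- by move=> X _; rewrite lee_fin indicE; case: (_ \in _).
Qed.

(** The exponential is the inverse of [hard_prob B], which is positive and finite; in this form its
    measurability follows from that of [expR] and [ln]. *)
Definition round_weight (f : config R -> \bar R) (B : config R) : \bar R :=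
  f B * (bad_ind B * (expR (- ln (fine (hard_prob B))))%:E).

(** The density after one round started from the density [f]: the previous bad points are averaged
    out, and [Y] has to be hard away from them. *)
Definition round_density f (Y : config R) : \bar R :=
  \int[Pi]_X (round_weight f (bad X) * hard_ind r (out (bad X) Y)).

Lemma round_weight_ge0 f B : (forall X, 0 <= f X) -> 0 <= round_weight f B.
Proof.
move=> f0; apply: mule_ge0 => //; apply: mule_ge0; first exact: bad_ind_ge0.
by rewrite lee_fin expR_ge0.
Qed.

Lemma measurable_round_weight f :
  measurable_fun setT f -> measurable_fun setT (round_weight f).
Proof.
move=> mf; apply: emeasurable_funM => //; apply: emeasurable_funM.
  exact: measurable_bad_ind.
apply/measurable_EFinP; apply: measurableT_comp; first exact: measurable_expR.
apply: measurableT_comp => //; apply: measurableT_comp; first exact: measurable_ln.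
by apply: measurableT_comp => //; exact: measurable_hard_prob.
Qed.

(** Once [hard_prob] is divided out, [bad_points_exchange] replaces the kept points by those of an
    independent [Y], hard away from [bad X]. By [out_inn_superposition] the resampled points
    complete them to all of [Y]. *)
Lemma one_round (f h : config R -> \bar R) :
  measurable_fun setT f -> (forall X, 0 <= f X) -> (forall X, f (bad X) = f X) ->
  measurable_fun setT h -> (forall X, 0 <= h X) ->
  \int[Pi]_X (f X * (bad_ind X *
    \int[Pi]_Z h (out (bad X) X `|` inn (bad X) Z)%fset)) =
  \int[Pi]_Y (round_density f Y * h Y).
Proof.

move=> mf f0 fbad mh h0.
have mbad : measurable_fun setT (bad : config R -> config R) by exact: measurable_bad.
pose F := round_weight f.
have mF : measurable_fun setT F by exact: measurable_round_weight.
have F0 X : 0 <= F X by exact: round_weight_ge0.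
have NF X : hard_prob X * F X = f X * bad_ind X.
  rewrite /F /round_weight muleCA; congr (_ * _).
  rewrite muleCA -[RHS]mule1; congr (_ * _).
  have N0 : (0 < fine (hard_prob X))%R.
    rewrite fine_gt0// hard_prob_gt0 -ge0_fin_numE ?hard_prob_ge0//.
    exact: hard_prob_fin.
  rewrite -{1}(fineK (hard_prob_fin X)) -EFinM expRN lnK.
    by rewrite divff// gt_eqF.
  by rewrite posrE.
(* [psi] sees the bad points and the kept points, and averages over the fresh ones. *)
pose psi (p : config R * config R) := F p.1 * \int[Pi]_Z h (p.2 `|` inn p.1 Z)%fset.
have mpsi : measurable_fun setT psi.
  apply: emeasurable_funM; first exact: (measurableT_comp mF).
  apply: measurable_integral => [|x y]; last exact: h0.
  apply: (measurableT_comp mh); apply: measurable_fsetU.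
    exact: (measurableT_comp measurable_config_snd measurable_fst).
  apply: measurable_inn => //.
  exact: (measurableT_comp measurable_config_fst measurable_fst).
have Ih0 B U : 0 <= \int[Pi]_Z h (U `|` inn B Z)%fset by apply: integral_ge0.
have psi0 p : 0 <= psi p by rewrite mule_ge0.
transitivity (\int[Pi]_X (hard_prob (bad X) * psi (bad X, out (bad X) X))).
  by apply: eq_integral => X _; rewrite /psi /= [RHS]muleA NF fbad bad_ind_bad muleA.
rewrite (bad_points_exchange r_gt0 pPi)//.
transitivity (\int[Pi]_X \int[Pi]_Y (F (bad X) * hard_ind r (out (bad X) Y) * h Y)).
  apply: eq_integral => X _; rewrite /psi /=.
  have moutB : measurable_fun setT (fun Y => out (bad X) Y) by exact: measurable_out.
  have minnB : measurable_fun setT (fun Y => inn (bad X) Y) by exact: measurable_inn.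
  under eq_integral do rewrite muleCA.
  rewrite ge0_integralZl//; last 2 first.
  - apply: emeasurable_funM; first exact: measurable_hard_ind.
    apply: measurable_integral => // ; apply: (measurableT_comp mh).
    apply: measurable_fsetU; first exact: (measurableT_comp moutB measurable_fst).
    exact: (measurableT_comp minnB measurable_snd).
  - by move=> Y _; rewrite mule_ge0 ?hard_ind_ge0.
  rewrite (out_inn_superposition r_gt0 pPi)// -ge0_integralZl//; last 2 first.
  - by apply: emeasurable_funM => //; exact: measurable_hard_ind.
  - by move=> Y _; rewrite mule_ge0 ?hard_ind_ge0.
  by apply: eq_integral => Y _; rewrite muleA.
have mw : measurable_fun setT (fun p : config R * config R =>
    F (bad p.1) * hard_ind r (out (bad p.1) p.2)).
  apply: emeasurable_funM.
    by apply: (measurableT_comp mF); exact: (measurableT_comp mbad measurable_config_fst).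
  apply: measurable_hard_ind => //; apply: measurable_out => //.
  exact: (measurableT_comp mbad measurable_config_fst).
(* Integrating [X] out first leaves [round_density f Y] in front of [h Y]. *)
rewrite (fubini_tonelli (fun p : config R * config R =>
    F (bad p.1) * hard_ind r (out (bad p.1) p.2) * h p.2))//; last 2 first.
- by apply: emeasurable_funM => //; exact: (measurableT_comp mh).
- by move=> p; apply: mule_ge0 => //; apply: mule_ge0 => //; exact: hard_ind_ge0.
apply: eq_integral => Y _; rewrite /= ge0_integralZr//.
  exact: (measurableT_comp mw (pair2_measurable Y)).
by move=> X _; rewrite mule_ge0 ?hard_ind_ge0.
Qed.

Lemma round_density_ge0 f Y : (forall X, 0 <= f X) -> 0 <= round_density f Y.
Proof.
move=> f0; apply: integral_ge0 => X _.
by apply: mule_ge0; [exact: round_weight_ge0|exact: hard_ind_ge0].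
Qed.

(** By [hard_out_bad]. This preserves the invariant of the induction on rounds. *)
Lemma round_density_bad f Y : round_density f (bad Y) = round_density f Y.
Proof.
apply: eq_integral => X _; congr (_ * _); rewrite /hard_ind !indicE.
by congr ((nat_of_bool _)%:R%:E); apply/idP/idP; rewrite !inE /= hard_out_bad.
Qed.

Lemma measurable_round_density f : measurable_fun setT f -> (forall X, 0 <= f X) ->
  measurable_fun setT (round_density f).
Proof.
move=> mf f0.
have mbad : measurable_fun setT (bad : config R -> config R) by exact: measurable_bad.
have mF := measurable_round_weight mf.
apply: measurable_integral => [|Y X]; last first.
  by apply: mule_ge0; [exact: round_weight_ge0|exact: hard_ind_ge0].
apply: emeasurable_funM.
  by apply: (measurableT_comp mF); exact: (measurableT_comp mbad measurable_config_snd).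
apply: measurable_hard_ind => //; apply: measurable_out => //.
exact: (measurableT_comp mbad measurable_config_snd).
Qed.

End one_round.

(** * Law of the run *)

Section integral_restriction.
Context {R : realType} d (T : measurableType d) (m : {measure set T -> \bar R}).
Local Open Scope ereal_scope.

Lemma integral_indM D (f : T -> \bar R) :
  \int[m]_(x in D) f x = \int[m]_x ((\1_D x)%:E * f x).
Proof.
rewrite integral_mkcond; apply: eq_integral => x _.
by rewrite patchE indicE; case: ifP => _; rewrite ?mul1e ?mul0e.
Qed.

Lemma integral_mrestr D (mD : measurable D) (f : T -> \bar R) :
  measurable_fun setT f -> (forall x, 0 <= f x) ->
  \int[mrestr m mD]_x f x = \int[m]_(x in D) f x.
Proof.
move=> mf f0.
rewrite (@ge0_negligible_integral _ _ _ _ setT (~` D))//; last 2 first.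
- exact: measurableC.
- by rewrite /= /mrestr setICl measure0.
rewrite setTD setCK; apply: eq_measure_integral => A mA AD.
by rewrite /= /mrestr setIidl.
Qed.

End integral_restriction.

Section run_law.
Context {R : realType} (lam r : R).
Hypothesis r_gt0 : (0 < r)%R.
Context {d : measure_display} {T : measurableType d} (P : probability T R).
Variables (Q : nat -> {RV P >-> config R}) (K : R.-pker (config R) ~> (config R)).
Hypothesis run : prs_run lam r Q K.
Variable Pi : probability (config R) R.
Hypothesis pPi : is_poisson_process lam unit_square Pi.
Local Open Scope ereal_scope.
Notation bad := (bad r).
Notation inn := (inn r).
Notation out := (out r).

Definition state_at t (w : T) : config R := state r (fun i => Q i w) t.

(** Only the rounds before [t] are constrained, so [started t.+1] is the event [running r Q t]. *)
Definition started t : set T :=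
  [set w | forall s, (s < t)%N -> bad (state_at s w) <> fset0].

Lemma state_atS t w : state_at t.+1 w =
  (out (bad (state_at t w)) (state_at t w) `|` Q t.+1 w)%fset.
Proof. by rewrite /state_at /= fsetD_bad. Qed.

(** The space is arbitrary, so that the lemma also serves for the sigma-algebra generated by the
    samples up to [t]. *)
Lemma measurable_state d' (T' : measurableType d') (q : nat -> T' -> config R) t :
  (forall i, (i <= t)%N -> measurable_fun setT (q i)) ->
  measurable_fun setT (fun w => state r (fun i => q i w) t : config R).
Proof.
elim: t => [|t IH] mq; first exact: mq.
have mt : measurable_fun setT (fun w => state r (fun i => q i w) t : config R).
  by apply: IH => i it; apply: mq; exact: leqW.
rewrite [X in measurable_fun _ X](_ : _ = fun w =>
    let X := state r (fun i => q i w) t in (out (bad X) X `|` q t.+1 w)%fset : config R).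
  apply: measurable_fsetU; last exact: mq.
  by apply: measurable_out => //; exact: measurable_bad.
by apply/funext => w /=; rewrite fsetD_bad.
Qed.

Lemma measurable_started_gen d' (T' : measurableType d') (q : nat -> T' -> config R) t :
  (forall i, (i < t)%N -> measurable_fun setT (q i)) ->
  measurable [set w | forall s, (s < t)%N ->
    bad (state r (fun i => q i w) s) <> fset0].
Proof.
move=> mq; rewrite [X in measurable X](_ : _ = \bigcap_(s in [set s | (s < t)%N])
    ~` [set w | bad (state r (fun i => q i w) s) = fset0]).
  apply: bigcap_measurableType => s st; apply: measurableC; apply: measurable_fset0.
  apply: measurable_bad => //; apply: measurable_state => i si.
  by apply: mq; exact: leq_ltn_trans st.
by apply/seteqP; split.
Qed.

Lemma measurable_state_at t : measurable_fun setT (state_at t).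
Proof. by apply: measurable_state => i _. Qed.

Lemma measurable_started t : measurable (started t).
Proof. by apply: measurable_started_gen. Qed.

Lemma history_started t (A : set (config R)) : measurable A ->
  history Q t (started t.+1 `&` state_at t @^-1` A).
Proof.
move=> mA.
pose G := [set H | exists i (F : set (config R)),
        [/\ (i <= t)%N, measurable F & H = Q i @^-1` F]].
have mQ i : (i <= t)%N -> measurable_fun setT (Q i : g_sigma_algebraType G -> config R).
  move=> it _ F mF; rewrite setTI; apply: sub_sigma_algebra.
  by exists i, F.
apply: (@measurableI _ (g_sigma_algebraType G)).
  by apply: (@measurable_started_gen _ (g_sigma_algebraType G)) => i it; exact: mQ.
rewrite -[X in measurable X]setTI.
exact: (@measurable_state _ (g_sigma_algebraType G) (fun i => Q i) t mQ).
Qed.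

(** Both sides are Poisson on the resampling region, the right one as a restriction of [Pi]. A fresh
    sample can thus be modelled as [inn (bad X) Z] with [Z] of law [Pi]. *)
Lemma kernel_law (X : config R) F : measurable F ->
  K X F = Pi (inn (bad X) @^-1` F).
Proof.
move=> mF.
have mn := measurable_near_of_cst r_gt0 (bad X).
have [m' [m'E _]] := image_measure Pi (measurable_sel_cst mn).
rewrite -[RHS](m'E F); apply: poisson_process_unique mF.
  exact: (prs_kernel run).
by rewrite resample_regionE; exact: poisson_process_sel m'E.
Qed.

(** On [started t.+1], the current state and the fresh sample have the joint law of the state and
    the near part of an independent [Z]; rectangles suffice to check this. *)
Lemma next_state_integral t (h : config R -> \bar R) :
  measurable_fun setT h -> (forall X, 0 <= h X) ->
  \int[P]_(w in started t.+1) h (state_at t.+1 w) =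
  \int[P]_(w in started t.+1) \int[Pi]_Z
    h (out (bad (state_at t w)) (state_at t w) `|` inn (bad (state_at t w)) Z)%fset.
Proof.
move=> mh h0.
have mG := measurable_started t.+1; set G := started t.+1.
have mGT : measurable (G `*` [set: config R]) by exact: measurableX.
have mst := measurable_state_at t.
pose k (p : config R * config R) := h (out (bad p.1) p.1 `|` p.2)%fset.
have mbad : measurable_fun setT (bad : config R -> config R) by exact: measurable_bad.
have mk : measurable_fun setT k.
  apply: (measurableT_comp mh); apply: measurable_fsetU; last exact: measurable_snd.
  by apply: measurable_out => //; exact: (measurableT_comp mbad measurable_config_fst).
have k0 p : 0 <= k p by exact: h0.
have mst1 : measurable_fun setT (fun p : T * config R => state_at t p.1).
  exact: (measurableT_comp mst measurable_fst).
have mg : measurable_fun setT (fun p : T * config R =>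
    (state_at t p.1, inn (bad (state_at t p.1)) p.2)).
  apply: measurable_fun_pair => //; apply: measurable_inn => //.
  exact: (measurableT_comp mbad mst1).
have mf : measurable_fun setT (fun w => (state_at t w, (Q t.+1 w : config R))).
  exact: measurable_fun_pair.
transitivity (\int[mrestr P mG]_w k (state_at t w, Q t.+1 w)).
  rewrite integral_mrestr//; last exact: (measurableT_comp mk mf).
  by apply: eq_integral => w _; rewrite state_atS.
transitivity (\int[mrestr (P \x Pi) mGT]_p
    k (state_at t p.1, inn (bad (state_at t p.1)) p.2)).
  apply: (@eq_joint_law_integral _ _ _ _ _ _ _ _ _ (mrestr P mG) (mrestr (P \x Pi) mGT)
    (fun w => (state_at t w, (Q t.+1 w : config R)))
    (fun p : T * config R => (state_at t p.1, inn (bad (state_at t p.1)) p.2))) => //.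
    rewrite /= /mrestr setTI; apply: le_lt_trans (probability_le1 _ _) _ => //.
    by rewrite ltry.
  move=> A B mA mB.
  have mH : measurable (G `&` state_at t @^-1` A).
    by apply: measurableI => //; exact: measurable_preimage.
  transitivity (P ((G `&` state_at t @^-1` A) `&` Q t.+1 @^-1` B)).
    rewrite /= /mrestr; congr (P _); apply/seteqP; split=> w /=.
      by move=> [[]].
    by move=> [[]].
  (* The condition on the current state belongs to the history, so freshness turns the probability
     into an integral of the kernel, and [kernel_law] into one of [Pi]. *)
  rewrite (prs_fresh run)//; last first.
    exact: history_started.
  rewrite /= /mrestr; set C := (_ @^-1` (A `*` B)) `&` _.
  have mC : measurable C.
    apply: measurableI => //; apply: (measurable_preimage mg).
    exact: measurableX.
  have -> : (P \x Pi) C = \int[P]_w Pi (xsection C w) by [].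
  rewrite integral_indM; apply: eq_integral => w _.
  rewrite kernel_law// indicE; case: (boolP (w \in _)) => [/set_mem[Gw Aw]|/negP nw].
    rewrite mul1e; congr (Pi _); apply/seteqP; split=> Z.
      by move=> BZ; apply/mem_set.
    by move=> /set_mem[[]].
  rewrite mul0e (_ : xsection C w = set0) ?measure0//.
  apply/seteqP; split => // Z /set_mem[[/= Aw BZ] [Gw _]]; apply: nw.
  by apply/mem_set.
rewrite integral_mrestr//; last exact: (measurableT_comp mk mg).
rewrite integral_indM.
rewrite (fubini_tonelli1 (fun p : T * config R => (\1_(G `*` [set: config R]) p)%:E *
   k (state_at t p.1, inn (bad (state_at t p.1)) p.2)))//; last 2 first.
- apply: emeasurable_funM; first exact: measurable_indE.
  exact: (measurableT_comp mk mg).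
- by move=> p; rewrite mule_ge0 ?lee_fin.
rewrite [RHS]integral_indM; apply: eq_integral => w _; rewrite /fubini_F /=.
rewrite -ge0_integralZl//; last first.
- apply: (measurableT_comp mh); apply: measurable_fsetU.
    exact: (@measurable_cst _ _ (config R) (config R) setT).
  by apply: measurable_inn => //; exact: (@measurable_cst _ _ (config R) (config R) setT).
apply: eq_integral => Z _; congr (_ * _).
by rewrite !indicE in_setX in_setT andbT.
Qed.

(** Unnormalized density of [state_at t] on [started t] with respect to [Pi]; its total mass is the
    probability of [started t]. *)
Fixpoint density t : config R -> \bar R :=
  if t is t'.+1 then round_density r Pi (density t') else cst 1.

Lemma density_ge0 t X : 0 <= density t X.
Proof. by elim: t X => [|t IH] X //=; exact: round_density_ge0. Qed.

Lemma density_bad t X : density t (bad X) = density t X.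
Proof. by case: t => [|t]; [by []|exact: round_density_bad]. Qed.

Lemma measurable_density t : measurable_fun setT (density t).
Proof.
elim: t => [|t IH] /=; first exact: measurable_cst.
by apply: measurable_round_density => //; exact: density_ge0.
Qed.

Lemma state_law t (h : config R -> \bar R) :
  measurable_fun setT h -> (forall X, 0 <= h X) ->
  \int[P]_(w in started t) h (state_at t w) = \int[Pi]_X (density t X * h X).
Proof.
elim: t h => [|t IH] h mh h0.
  under [RHS]eq_integral do rewrite /= mul1e.
  rewrite (_ : started 0 = setT); last by apply/seteqP; split.
  apply: (@eq_law_integral _ _ _ _ _ _ _ P Pi (state_at 0) id) => //.
  by move=> A mA; exact: (poisson_process_unique (prs_init run) pPi).
rewrite next_state_integral//.
pose Phi X := \int[Pi]_Z h (out (bad X) X `|` inn (bad X) Z)%fset.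
have Phi0 X : 0 <= Phi X by apply: integral_ge0.
have mbad : measurable_fun setT (bad : config R -> config R) by exact: measurable_bad.
have mb1 := measurableT_comp mbad measurable_config_fst.
have mPhi : measurable_fun setT Phi.
  apply: measurable_integral => [|X Z]; last exact: h0.
  apply: (measurableT_comp mh); apply: measurable_fsetU; first exact: measurable_out.
  exact: (measurable_inn r_gt0 mb1 measurable_snd).
(* [started t.+1] is [started t] together with a condition on the state at time [t], which moves
   into the integrand. *)
transitivity (\int[P]_(w in started t) (bad_ind r (state_at t w) * Phi (state_at t w))).
  rewrite integral_indM [RHS]integral_indM; apply: eq_integral => w _.
  rewrite muleA; congr (_ * _).
  rewrite /bad_ind -EFinM !indicE -natrM mulnb; congr ((nat_of_bool _)%:R%:E).
  apply/idP/andP => [/set_mem sw|[/set_mem sw /set_mem bw]].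
    split; apply/mem_set; last exact: sw.
    by move=> s st; apply: sw; exact: ltnW.
  by apply/mem_set => s; rewrite ltnS leq_eqVlt => /predU1P[->//|]; exact: sw.
rewrite (IH (fun X => bad_ind r X * Phi X)).
- apply: (one_round r_gt0 pPi) => //.
  + exact: measurable_density.
  + exact: density_ge0.
  + exact: density_bad.
- by apply: emeasurable_funM => //; exact: measurable_bad_ind.
- by move=> X; apply: mule_ge0 => //; exact: bad_ind_ge0.
Qed.

(** * Halting times and law of the output *)

Definition halted_at t (E : set (config R)) : set T :=
  started t `&` state_at t @^-1` ([set X | bad X = fset0] `&` E).

Lemma measurable_hard : measurable ([set X | bad X = fset0] : set (config R)).
Proof. by apply: measurable_fset0; exact: measurable_bad. Qed.

Lemma measurable_halted_at t E : measurable E -> measurable (halted_at t E).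
Proof.
move=> mE; apply: measurableI; first exact: measurable_started.
apply: (measurable_preimage (measurable_state_at t)).
by apply: measurableI => //; exact: measurable_hard.
Qed.

(** The density depends only on the bad points, so on hard configurations it is the constant
    [density t fset0]. *)
Lemma halted_at_law t E : measurable E ->
  P (halted_at t E) = density t fset0 * Pi ([set X | bad X = fset0] `&` E).
Proof.
move=> mE.
have mHE : measurable ([set X | bad X = fset0] `&` E : set (config R)).
  by apply: measurableI => //; exact: measurable_hard.
have -> : P (halted_at t E) = \int[P]_(w in started t)
    (\1_([set X | bad X = fset0] `&` E : set (config R)) (state_at t w))%:E.
  have mh := measurable_halted_at t mE.
  have -> : P (halted_at t E) = \int[P]_w (\1_(halted_at t E) w)%:E.
    by rewrite integral_indic// setIT.
  rewrite [RHS]integral_indM; apply: eq_integral => w _.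
  by rewrite /halted_at -EFinM indicI.
rewrite (state_law t (h := fun X =>
  (\1_([set X | bad X = fset0] `&` E : set (config R)) X)%:E))//.
- have -> : Pi ([set X | bad X = fset0] `&` E) = \int[Pi]_X
      (\1_([set X | bad X = fset0] `&` E : set (config R)) X)%:E.
    by rewrite integral_indic// setIT.
  rewrite -ge0_integralZl//; last 2 first.
  + exact: measurable_indE.
  + exact: density_ge0.
  apply: eq_integral => X _; rewrite indicE.
  case: (boolP (X \in _)) => [/set_mem[/= bX _]|_]; last by rewrite !mule0.
  by rewrite -(density_bad t X) bX.
- exact: measurable_indE.
Qed.

Lemma outputsE (E : set (config R)) :
  [set w | exists2 X, outputs r (fun t => Q t w) X & E X] = \bigcup_t halted_at t E.
Proof.
apply/seteqP; split=> w /=.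
  by move=> [X [t [rt bt <-]] EX]; exists t.
move=> [t _ [rt [bt Et]]]; exists (state_at t w) => //.
by exists t.
Qed.

Lemma trivIset_halted_at E : trivIset setT (halted_at ^~ E).
Proof.
apply/trivIsetP => i j _ _.
wlog ij : i j / (i < j)%N.
  move=> H; rewrite neq_lt => /orP[ij|ji]; first by apply: H => //; rewrite lt_eqF.
  by rewrite setIC; apply: H => //; rewrite lt_eqF.
move=> _; apply/seteqP; split=> // w [[_ [bi _]] [rj _]].
exact: rj ij bi.
Qed.

(** Halting events at different times are disjoint, so their laws add up to [Pi] on hard
    configurations times a constant independent of [E]. *)
Lemma output_law (E : set (config R)) : measurable E ->
  P [set w | exists2 X, outputs r (fun t => Q t w) X & E X] =
  (\sum_(0 <= t <oo) density t fset0) * Pi ([set X | bad X = fset0] `&` E).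
Proof.
move=> mE; rewrite outputsE measure_bigcup//; last 2 first.
- by move=> t _; exact: measurable_halted_at.
- exact: trivIset_halted_at.
have mHE : measurable ([set X | bad X = fset0] `&` E : set (config R)).
  by apply: measurableI => //; exact: measurable_hard.
(* The common factor is finite, hence a real that can be pulled out of the series. *)
rewrite -(fineK (fin_num_measure Pi _ mHE)) muleC -nneseriesZl; last first.
  by move=> t _; exact: density_ge0.
rewrite (eq_eseriesl (Q := xpredT)); last by move=> t; rewrite in_setT.
apply: eq_eseriesr => t _.
rewrite (fineK (fin_num_measure Pi _ mHE)) muleC; exact: halted_at_law.
Qed.

Lemma measurable_outputs (E : set (config R)) : measurable E ->
  measurable [set w | exists2 X, outputs r (fun t => Q t w) X & E X].
Proof.
move=> mE; rewrite outputsE; apply: bigcup_measurable => t _.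
exact: measurable_halted_at.
Qed.

End run_law.

(** * Conditioning on halting *)

Theorem theorem1 (R : realType) (lam r : R) (lam_gt0 : 0 < lam) (r_gt0 : 0 < r)
    (d : measure_display) (T : measurableType d) (P : probability T R)
    (Q : nat -> {RV P >-> config R}) (K : R.-pker (config R) ~> (config R))
    (run : prs_run (lam / (pi * r ^+ 2)) r Q K)
    (Pi : probability (config R) R)
    (poissonPi : is_poisson_process (lam / (pi * r ^+ 2)) unit_square Pi)
    (E : set (config R)) (mE : measurable E) :
  cond_prob P [set w | halts r (fun t => Q t w)]
    [set w | exists2 X, outputs r (fun t => Q t w) X & E X] =
  hard_disks r Pi E.
Proof.
have law (F : set (config R)) (mF : measurable F) :=
  output_law r_gt0 run poissonPi mF.
rewrite /hard_disks /cond_prob.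
have -> : [set w | exists2 X, outputs r (fun t => Q t w) X & E X] `&`
    [set w | halts r (fun t => Q t w)] =
    [set w | exists2 X, outputs r (fun t => Q t w) X & E X].
  by apply/setIidl => w [X oX _]; exists X.
(* Halting is the case of the full event, so [law] gives its probability too. *)
have -> : [set w | halts r (fun t => Q t w)] =
    [set w | exists2 X, outputs r (fun t => Q t w) X & [set: config R] X].
  by apply/seteqP; split=> w [X oX]; exists X.
(* This bound will exclude an infinite constant [C]. *)
have PH1 := probability_le1 P (measurable_outputs r_gt0 Q measurableT).
rewrite (law _ mE) (law _ measurableT) in PH1 *.
rewrite setIT [E `&` _]setIC in PH1 *.
set hard : set (config R) := [set X | bad r X = fset0] in PH1 *.
rewrite -[X in (_ = Pi (X `&` _) / Pi X)%E]/hard.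
set C := (\sum_(0 <= t <oo) _)%E in PH1 *.
have mhard : measurable hard by exact: measurable_hard.
have b0 : (0 < Pi hard)%E.
  apply: lt_le_trans (poisson_process_void poissonPi) _.
  apply: le_measure; rewrite ?inE//; first exact: (@measurable_fset0 _ _ (config R) id).
  by move=> X /= ->; apply/hardP => x; apply/negP => /bad_sub; rewrite in_fset0.
(* The term of index 0 is 1: the constant is positive, and so is the probability of halting. *)
have C1 : (1 <= C)%E.
  apply: le_trans (nneseries_lim_ge 1 _); last by move=> t *; exact: density_ge0.
  by rewrite big_nat1.
have ha : Pi (hard `&` E) \is a fin_num.
  by apply: fin_num_measure; exact: measurableI.
have hb : Pi hard \is a fin_num by exact: fin_num_measure.
move: PH1 b0 C1; rewrite -(fineK ha) -(fineK hb).
set a := fine _; set b := fine _.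
(* An infinite [C] would make the probability of halting infinite; a finite one cancels in the
   quotient. *)
case: C => [c| |//]; last first.
  by move=> + b0 _; rewrite gt0_mulye.
move=> _; rewrite lte_fin lee_fin => b0 c1.
have c0 : 0 < c by exact: lt_le_trans ltr01 c1.
rewrite -!EFinM !inver mulf_eq0 !gt_eqF//= -!EFinM; congr _%:E.
by rewrite -mulf_div divff ?mul1r// gt_eqF.
Qed.
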